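(* There exists an absolute constant $c>0$ such that the following holds. Suppose that $A\subseteq A_n$ is a normal set of density $\frac{|A|}{|A_n|}\ge n^{-cn^{1/3}}$. Then $A^3=A_n$.
   Context: $A_n$ is the alternating group on $n$ letters. A subset of $A_n$ is normal if it is closed under conjugation in $A_n$. $A^3=\{a_1a_2a_3: a_1,a_2,a_3\in A\}$. *)

(* Defs.v *)
From mathcomp Require Import all_boot all_order all_algebra all_fingroup all_solvable.
From mathcomp Require Import reals exp.
Set Implicit Arguments.
Unset Strict Implicit.
Unset Printing Implicit Defensive.
Import Order.TTheory GRing.Theory Num.Theory.

(* A normal subset is a set of even permutations, not necessarily a subgroup. *)
Definition normal_subset_Alt (n : nat) (A : {set 'S_n}) : Prop :=
  A \subset ('Alt_('I_n))%g /\
  {in A & ('Alt_('I_n))%g, forall a g : 'S_n, (a ^ g)%g \in A}.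

Definition density_Alt (R : realType) (n : nat) (A : {set 'S_n}) : R :=
  (#|A|%:R / #|('Alt_('I_n))%g|%:R)%R.

(* Main.v *)
Require Import Defs.
From mathcomp Require Import all_boot all_order all_algebra all_fingroup all_solvable.
From mathcomp Require Import reals exp.
From mathcomp Require Import sequences zify ring lra.

(** Why the theorem is true.

    A permutation fixes at least 2 ^ k subsets when it has k cycles, and by
    Burnside's orbit count the numbers of fixed subsets add up to (n + 1) n! over
    the symmetric group.  So permutations with at least k cycles have density at
    most (n + 1) / 2 ^ k [card_many_porbits].  As n ^ (1/3) log n is O(sqrt n),
    the density hypothesis with a small c forces A to contain, for large n, an
    element si whose number k of cycles satisfies k (2 k + 20) <= n.  For bounded n,
    a tiny c leaves only A = A_n [small_case].  It remains to see that a conjugacy class of A_n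
    with few cycles has cube A_n [class_cube]; this is done by gluing cycles, with
    no character theory.

    The engine is [hub_exists].  Two cycle types on N points, with k and m
    cycles, k + m <= N + 1 and k + m = N + 1 modulo 2, are the types of two
    permutations whose product is a single N-cycle.  When k + m = N + 1 the
    cycles are the vertices and the points the edges of a bipartite tree, which is
    built leaf by leaf.  Otherwise some cycle has at least three points; replace
    two of them by fixed points, and afterwards merge the two fixed points back by
    a 3-cycle.  One of the two orientations of this 3-cycle merely exchanges two
    arcs of the N-cycle.

    A class of the symmetric group may split into two classes of A_n, so parities
    of conjugators matter.  They are adjusted at the very end: three permutations
    with a common point x receive six new points, through powers of one 7-cycle r
    on x and the new points.  Some odd w fixing x satisfies r ^ w = r ^ 3, so the
    choice between r ^ (3 ^ j) for j even or odd switches the parity of a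
    conjugator, and all eight sign patterns occur among the solutions of
    3 ^ j1 + 3 ^ j2 + 3 ^ j3 = 0 modulo 7 [prescribed_parities].

    Let ta be even.  If ta and si together have at most about n cycles, both
    si * si and ta * si^-1 reach, up to conjugation, an n-cycle or (n even) an
    (n-1)-cycle, so ta is a product of three conjugates [far_cube].  The signs in
    the second product come from a 7-cycle if ta has a cycle of length at least 8,
    and otherwise from an odd permutation commuting with ta, which exists because
    two cycles of ta have the same length.

    If ta has more cycles, its support is so small that it fits into the longest
    cycle of si.  There ta is a product of three full cycles on an odd number of
    points, and the remaining cycles of si are completed by triples of
    permutations with product 1: three l-cycles for each odd length l, and for the
    even lengths, taken in pairs, an extension of two odd blocks by two new points
    [near_cube]. *)

Set Implicit Arguments.
Unset Strict Implicit.
Unset Printing Implicit Defensive.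

(** * Decompositions into cycles *)

Section CycleDecomposition.
Local Open Scope group_scope.

Variable T : finType.
Implicit Types (al be ga : {perm T}) (A B C S X Y Z : seq T) (L : seq (seq T)).

(** The lists of L are the cycles of al, each read along al; points outside L are
    fixed.  Fixed points may or may not be listed, so that L also records the set
    of points on which al is considered. *)
Definition cycle_decomp al L :=
  [/\ uniq (flatten L), all (fcycle al) L & forall x, x \notin flatten L -> al x = x].

Lemma eq_in_fcycle al be C : {in C, al =1 be} -> fcycle al C = fcycle be C.
Proof.
move=> eq_ab; apply: (@eq_in_cycle _ (mem C)); last exact/allP.
by move=> x y Cx _; rewrite /= eq_ab.
Qed.

Lemma eq_in_fpath al be x s : {in belast x s, al =1 be} ->
  fpath al x s = fpath be x s.
Proof.
elim: s x => //= y s IH x eq_ab; rewrite eq_ab ?mem_head // IH //.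
by move=> z sz; apply: eq_ab; rewrite in_cons sz orbT.
Qed.

Lemma cycle_decomp_perm al L L' :
  cycle_decomp al L -> perm_eq L L' -> cycle_decomp al L'.
Proof.
move=> [uL cL fL] pL; have pf := perm_flatten pL.
split; first by rewrite -(perm_uniq pf).
  by rewrite -(perm_all _ pL).
by move=> x; rewrite -(perm_mem pf) => ?; apply: fL.
Qed.

Lemma cycle_decomp_rot al n C L :
  cycle_decomp al (C :: L) -> cycle_decomp al (seq.rot n C :: L).
Proof.
move=> [uL cL fL]; have pf : perm_eq (seq.rot n C ++ flatten L) (C ++ flatten L).
  by rewrite perm_cat2r perm_rot.
split=> /=; first by rewrite (perm_uniq pf).
  by rewrite rot_cycle.
by move=> x; rewrite (perm_mem pf) => ?; apply: fL.
Qed.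

Lemma cycle_decomp_rot_to al x C L : cycle_decomp al (C :: L) -> x \in C ->
  exists2 s, perm_eq C (x :: s) & cycle_decomp al ((x :: s) :: L).
Proof.
move=> dL /rot_to [i s rotC]; exists s; first by rewrite -rotC perm_sym perm_rot.
by rewrite -rotC; apply: cycle_decomp_rot.
Qed.

Lemma cycle_decomp_drop al x L :
  cycle_decomp al ([:: x] :: L) -> cycle_decomp al L.
Proof.
move=> [/= /andP[_ uL] /andP[/andP[/eqP ax _] cL] fL]; split=> // y Ly.
have [-> //|nyx] := eqVneq y x; apply: fL.
by rewrite /= inE negb_or nyx.
Qed.

Lemma cycle_decomp_add al x L : cycle_decomp al L -> x \notin flatten L ->
  cycle_decomp al ([:: x] :: L).
Proof.
move=> [uL cL fL] Lx; split=> /=; first by rewrite Lx.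
  by rewrite fL ?eqxx.
by move=> y; rewrite /= inE negb_or => /andP[_ Ly]; apply: fL.
Qed.

Lemma fcycle_mem al C x : fcycle al C -> (al x \in C) = (x \in C).
Proof.
move=> cC; apply/idP/idP => [|Cx]; last first.
  by rewrite (mem_fcycle cC).
move=> Cax; have := prev_cycle cC Cax => /eqP /perm_inj <-.
by rewrite mem_prev.
Qed.

Lemma perm_flatten_rev L : perm_eq (flatten (map rev L)) (flatten L).
Proof. by elim: L => //= C L IH; apply: perm_cat => //; rewrite perm_rev. Qed.

Lemma shape_map_rev L : shape (map rev L) = shape L.
Proof. by rewrite /shape -map_comp; apply: eq_map => C /=; rewrite size_rev. Qed.

Lemma cycle_decompV al L :
  cycle_decomp al L -> cycle_decomp al^-1 (map rev L).
Proof.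
move=> [uL cL fL]; have pf := perm_flatten_rev L.
split; first by rewrite (perm_uniq pf).
  rewrite all_map; apply: sub_all cL => C /= cC.
  rewrite rev_cycle; apply: etrans cC; apply: eq_cycle => x y /=.
  by apply/eqP/eqP => [<-|<-]; rewrite ?permKV ?permK.
move=> x; rewrite (perm_mem pf) => Lx.
by apply: (@perm_inj _ al); rewrite permKV fL.
Qed.

Lemma cycle_decompJ al g L :
  cycle_decomp al L -> cycle_decomp (al ^ g) (map (map g) L).
Proof.
move=> [uL cL fL].
split; first by rewrite -map_flatten map_inj_uniq //; apply: perm_inj.
  rewrite all_map; apply: sub_all cL => C /= cC.
  rewrite cycle_map; apply: etrans cC; apply: eq_cycle => x y /=.
  by rewrite permJ (inj_eq perm_inj).
move=> x; rewrite -map_flatten -(permKV g x) mem_map; last exact: perm_inj.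
by move=> Lx; rewrite permJ fL.
Qed.

Lemma fcycle_insert al x p s : uniq (p :: x :: s) -> al p = p ->
  fcycle al (x :: s) -> fcycle (tperm x p * al) (x :: p :: s).
Proof.
rewrite /= inE negb_or -andbA => /and4P[px ps xs us] alp.
case: s px ps xs us => [|y s] px ps xs us.
  rewrite /= andbT => /eqP ax.
  by rewrite !permM tpermL tpermR alp ax !eqxx.
case/andP=> ax cs.
apply/and3P; split; rewrite /= ?permM ?tpermL ?tpermR ?alp //.
apply: etrans cs; apply: eq_in_fpath => z; rewrite belast_rcons => sz.
rewrite permM tpermD //; [by apply: contraNneq xs => -> | by apply: contraNneq ps => ->].
Qed.

(** Multiplication by a transposition with a fixed point of al lengthens the cycle
    of x by one point: p is inserted right after x. *)
Lemma cycle_decomp_insertl al x p C L :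
    cycle_decomp al (C :: L) -> x \in C -> p \notin flatten (C :: L) ->
  exists2 C', perm_eq C' (p :: C) & cycle_decomp (tperm x p * al) (C' :: L).
Proof.
move=> dL xC pL; have [s pC [uL cL fL]] := cycle_decomp_rot_to dL xC.
have pf : perm_eq (flatten (C :: L)) (x :: s ++ flatten L).
  by rewrite /= -cat_cons perm_cat2r.
have alp : al p = p by apply: fL; rewrite -(perm_mem pf).
rewrite (perm_mem pf) in pL.
exists (x :: p :: s).
  apply: perm_trans (permEl (perm_catCA [:: x] [:: p] s)) _.
  by rewrite perm_cons perm_sym.
have uL' : uniq (p :: x :: s ++ flatten L) by rewrite /= in uL *; rewrite pL.
have px : x != p by apply: contraNneq pL => ->; rewrite inE eqxx.
move: (uL'); rewrite -2!cat_cons cat_uniq => /and3P[upxs dis uf].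
case/andP: cL => cC cL; split=> /=.
- by apply: etrans uL'; apply: perm_uniq (permEl (perm_catCA [:: x] [:: p] _)).
- apply/andP; split; first exact: (fcycle_insert upxs).
  apply: etrans cL; apply: eq_in_all => D LD; apply: eq_in_fcycle => z Dz.
  have zf : z \in flatten L by apply/flattenP; exists D.
  have /norP[] : ~~ [|| z == p, z == x | z \in s].
    by apply: contra dis => ?; apply/hasP; exists z; rewrite ?inE.
  by rewrite negb_or => zp /andP[zx _]; rewrite permM tpermD // eq_sym.
- move=> z; rewrite /= !inE !negb_or => /and3P[zx zp zL].
  rewrite permM tpermD 1?eq_sym //; apply: fL.
  by rewrite /= inE negb_or zx.
Qed.

(** Moving the transposition across al reduces to insertion on the left, at the
    preimage of x. *)
Lemma cycle_decomp_insertr al x p C L :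
    cycle_decomp al (C :: L) -> x \in C -> p \notin flatten (C :: L) ->
  exists2 C', perm_eq C' (p :: C) & cycle_decomp (al * tperm x p) (C' :: L).
Proof.
move=> dL xC pL; have -> : al * tperm x p = tperm (al^-1 x) p * al.
  have [_ _ fL] := dL; have alp : al^-1 p = p.
    by apply: (@perm_inj _ al); rewrite permKV fL.
  by rewrite -{2}alp -tpermJ conjgE invgK mulgA mulgKV.
apply: cycle_decomp_insertl => //; have [_ /andP[cC _] _] := dL.
by rewrite -(fcycle_mem _ cC) permKV.
Qed.

End CycleDecomposition.

(** * Conjugation, parity and number of cycles *)

Section Conj.
Local Open Scope group_scope.
Variable T : finType.
Implicit Types (al be ga : {perm T}) (A B C S X Y Z : seq T) (L : seq (seq T)).

Lemma cycle_decomp_inj al be L :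
  cycle_decomp al L -> cycle_decomp be L -> al = be.
Proof.
move=> [_ /allP ca fa] [_ /allP cb fb]; apply/permP => x.
have [/flattenP[C LC Cx]|nLx] := boolP (x \in flatten L); last by rewrite fa ?fb.
have /eqP -> := next_cycle (ca C LC) Cx.
by have /eqP -> := next_cycle (cb C LC) Cx.
Qed.

(** Two enumerations of the same set differ by a permutation; this is the source of
    all conjugating elements below. *)
Lemma perm_extending_map S S' : uniq S -> perm_eq S S' ->
  exists2 g : {perm T}, map g S = S' & forall x, x \notin S -> g x = x.
Proof.
move=> uS pS; have uS' : uniq S' by rewrite -(perm_uniq pS).
have sS := perm_size pS; have mS := perm_mem pS.
pose f x := if x \in S then nth x S' (index x S) else x.
have fS x : (f x \in S) = (x \in S).
  rewrite /f; case: ifP => // Sx; rewrite mS mem_nth // -sS index_mem //.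
have f_inj : injective f.
  move=> x y fxy; have := fS x; rewrite fxy fS => Sxy.
  move: fxy; rewrite /f Sxy; case: ifP => // Sx /eqP; have Sy : y \in S by rewrite Sxy.
  rewrite (set_nth_default y) -?sS ?index_mem // nth_uniq -?sS ?index_mem // => /eqP eqi.
  by rewrite -(nth_index y Sx) eqi nth_index.
exists (perm f_inj); last by move=> x nSx; rewrite permE /f (negPf nSx).
have -> : map (perm f_inj) S = map f S by apply: eq_map => x; rewrite permE.
case defS: S sS => [|x0 S0] sS.
  by move: sS => /esym/size0nil ->.
rewrite -defS in sS *; apply: (@eq_from_nth _ x0); rewrite size_map // => i si.
rewrite (nth_map x0) // /f mem_nth // index_uniq //.
by apply: set_nth_default; rewrite -sS.
Qed.

(** Matching the cycles of al with those of be position by position conjugates one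
    into the other. *)
Lemma cycle_decomp_conj al be L L' :
    cycle_decomp al L -> cycle_decomp be L' -> perm_eq (flatten L) (flatten L') ->
    shape L = shape L' ->
  exists g : {perm T}, [/\ al ^ g = be, map (map g) L = L'
    & forall x, x \notin flatten L -> g x = x].
Proof.
move=> dL dL' pL sL; have [uL _ _] := dL.
have [g gL gfix] := perm_extending_map uL pL; exists g.
have mapL : map (map g) L = L'.
  apply: eq_from_flatten_shape; first by rewrite -map_flatten.
  by rewrite -sL /shape -map_comp; apply: eq_map => C /=; rewrite size_map.
split=> //; apply: cycle_decomp_inj dL'; rewrite -mapL.
exact: cycle_decompJ.
Qed.

Lemma fcycle_porbit al C x : uniq C -> fcycle al C -> x \in C ->
  porbit al x = [set y in C].
Proof.
move=> uC cC Cx; apply/setP => y; rewrite inE.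
have iterC i : iter i al x \in C by elim: i => //= i; rewrite fcycle_mem.
apply/porbitP/idP => [[i ->]|]; first by rewrite permX.
case: (rot_to Cx) => i s rotC; move: cC; rewrite -(rot_cycle i) rotC.
move=> /fpathE; rewrite size_rcons => def_s.
rewrite -(mem_rot i) rotC.
have -> : x :: s = traject al x (size s).+1.
  by rewrite trajectS; congr (_ :: _); move/(congr1 (take (size s))): def_s;
    rewrite take_traject // -cats1 take_size_cat.
by case/trajectP => j _ ->; exists j; rewrite permX.
Qed.

Lemma exists_cycle_decomp_on al S : uniq S -> (forall x, x \in S -> al x \in S) ->
  exists L, [/\ perm_eq (flatten L) S, all (fcycle al) L & [::] \notin L].
Proof.
have [n] := ubnP (size S); elim: n S => // n IH [|x S] sS uS closedS.
  by exists [::].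
pose S2 := filter (predC (mem (fingraph.orbit al x))) (x :: S).
have al_inj := @perm_inj _ al.
have sub : {subset fingraph.orbit al x <= x :: S}.
  move=> y; rewrite -fconnect_orbit => /iter_findex <-.
  elim: (findex _ _ _) => [|i IHi] /=; [exact: mem_head | exact: closedS].
have pS : perm_eq (fingraph.orbit al x ++ S2) (x :: S).
  rewrite perm_sym -(perm_filterC (mem (fingraph.orbit al x))) perm_cat2r.
  apply: uniq_perm; rewrite ?filter_uniq ?orbit_uniq // => y.
  by rewrite mem_filter /=; case: (boolP (y \in fingraph.orbit _ _)) => //= /sub ->.
have := perm_size pS; rewrite size_cat size_orbit => eqs.
have [||y|L [pL cL nL]] := IH S2.
- by have := fingraph.order_gt0 al x; rewrite /= in eqs sS; lia.
- exact: filter_uniq.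
- rewrite !mem_filter /= => /andP[oy Sy]; rewrite closedS // andbT.
  by apply: contra oy; rewrite -!fconnect_orbit -same_fconnect1_r.
exists (fingraph.orbit al x :: L); split=> /=.
- by apply: perm_trans pS; rewrite perm_cat2l.
- by rewrite cycle_orbit.
- rewrite in_cons negb_or nL andbT eq_sym; apply: contraTneq (in_orbit al x) => ->.
  by [].
Qed.

(** All points are listed and no list is empty, hence size L is the number of cycles
    and shape L the cycle type. *)
Definition full_decomp al L :=
  [/\ cycle_decomp al L, perm_eq (flatten L) (enum T) & [::] \notin L].

Lemma exists_full_decomp al : exists L, full_decomp al L.
Proof.
have [//|L [pL cL nL]] := @exists_cycle_decomp_on al (enum T) (enum_uniq _).
  by move=> x _; rewrite mem_enum.
exists L; split=> //; split=> //; first by rewrite (perm_uniq pL) enum_uniq.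
by move=> x; rewrite (perm_mem pL) mem_enum.
Qed.

(** Disjoint nonempty cycles have distinct sets of points; this is what lets the
    number of orbits be read off a list. *)
Lemma uniq_cycle_sets L : uniq (flatten L) -> [::] \notin L ->
  uniq [seq [set y in C] | C <- L].
Proof.
elim: L => //= C L IH; rewrite cat_uniq => /and3P[_ dis uL].
rewrite in_cons negb_or => /andP[nC nL]; rewrite IH // andbT.
apply/negP => /mapP[D LD] /setP eqCD; case: C nC dis eqCD => // x C _ dis /(_ x).
rewrite !inE eqxx /= => /esym Dx; case/hasP: dis; exists x; rewrite ?inE ?eqxx //.
by apply/flattenP; exists D.
Qed.

Lemma porbits_full_decomp al L : full_decomp al L ->
  porbits al = [set O in [seq [set y in C] | C <- L]].
Proof.
case=> [[uL /allP cL fL] pL nL]; apply/setP => O; rewrite inE.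
have uC C : C \in L -> uniq C.
  move=> LC; move: uL; have /perm_flatten/perm_uniq -> := perm_to_rem LC.
  by rewrite /= cat_uniq => /and3P[].
apply/imsetP/mapP => [[x _ ->]|[C LC ->]].
  have: x \in flatten L by rewrite (perm_mem pL) mem_enum.
  by case/flattenP => C LC Cx; exists C => //; apply: fcycle_porbit; rewrite ?uC ?cL.
case: C LC => [|x C] LC; first by rewrite LC in nL.
by exists x => //; rewrite (fcycle_porbit _ (cL _ LC)) ?uC ?mem_head.
Qed.

Lemma card_porbits_full_decomp al L : full_decomp al L -> #|porbits al| = size L.
Proof.
move=> dL; rewrite (porbits_full_decomp dL) cardsE.
case: dL => [[uL _ _] _ nL].
by have /card_uniqP -> := uniq_cycle_sets uL nL; rewrite size_map.
Qed.

Lemma odd_perm_decomp al L : cycle_decomp al L -> [::] \notin L ->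
  odd_perm al = odd (size (flatten L)) (+) odd (size L).
Proof.
move=> dL nL; pose R := [seq x <- enum T | x \notin flatten L].
have [uL cL fL] := dL.
have pR : perm_eq (R ++ flatten L) (enum T).
  have uR : uniq R by apply: filter_uniq; apply: enum_uniq.
  apply: uniq_perm; rewrite ?enum_uniq // ?cat_uniq ?uR ?uL ?andbT /=.
    by apply/hasPn => x Lx; rewrite mem_filter Lx.
  by move=> x; rewrite mem_cat mem_filter !mem_enum andbT orNb.
have : full_decomp al ([seq [:: x] | x <- R] ++ L).
  rewrite /full_decomp flatten_cat flatten_seq1; split=> //.
    split; first by rewrite flatten_cat flatten_seq1 (perm_uniq pR) enum_uniq.
      rewrite all_cat cL andbT; apply/allP => _ /mapP[x Rx ->] /=.
      by rewrite fL ?eqxx //; move: Rx; rewrite mem_filter => /andP[].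
    move=> x; rewrite flatten_cat flatten_seq1 mem_cat negb_or => /andP[_].
    exact: fL.
  rewrite mem_cat negb_or nL andbT; apply/negP => /mapP[x _] //.
move=> /card_porbits_full_decomp; rewrite size_cat size_map => card_o.
rewrite /odd_perm card_o cardE -(perm_size pR) size_cat !oddD.
by do 3 case: odd.
Qed.

Lemma cycle_decomp_conj_shape al be L L' :
    cycle_decomp al L -> cycle_decomp be L' -> perm_eq (flatten L) (flatten L') ->
    perm_eq (shape L) (shape L') ->
  exists2 g : {perm T}, al ^ g = be & forall x, x \notin flatten L -> g x = x.
Proof.
move=> dL dL' pF /(perm_iotaP 0)[Is pIs eqs].
pose L2 := [seq nth [::] L' i | i <- Is].
have pL2 : perm_eq L' L2.
  rewrite size_map in pIs; rewrite perm_sym; apply/(perm_iotaP [::]).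
  by exists Is.
have sL2 : shape L = shape L2.
  rewrite eqs /shape -map_comp; apply/eq_in_map => i.
  rewrite (perm_mem pIs) mem_iota size_map add0n => /andP[_ li] /=.
  by rewrite (nth_map [::]).
have pF2 : perm_eq (flatten L) (flatten L2).
  by apply: perm_trans pF _; apply: perm_flatten.
have [g [alg _ gfix]] := cycle_decomp_conj dL (cycle_decomp_perm dL' pL2) pF2 sL2.
by exists g.
Qed.

Lemma full_decomp_conj al be L L' : full_decomp al L -> full_decomp be L' ->
  perm_eq (shape L) (shape L') -> exists g, al ^ g = be.
Proof.
move=> [dL pL _] [dL' pL' _] ps.
have pF : perm_eq (flatten L) (flatten L') by rewrite (perm_trans pL) // perm_sym.
by have [g] := cycle_decomp_conj_shape dL dL' pF ps; exists g.
Qed.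

End Conj.

(** * Gluing operations on pairs of permutations with a cyclic product *)

(** Counting the elements that satisfy an arbitrary predicate turns an equality
    of concatenations up to reordering into linear arithmetic. *)
Ltac perm_count :=
  let u := fresh "u" in apply/seq.permP => u;
  rewrite /=; repeat (rewrite count_cat /=);
  repeat match goal with
  | |- context [nat_of_bool ?b] => move: (nat_of_bool b) => ?
  | |- context [count u ?s] => move: (count u s) => ?
  end; clear; lia.

Section Hub.
Local Open Scope group_scope.
Variable T : finType.
Implicit Types (al be ga z : {perm T}) (A B C S X Y Z : seq T) (L : seq (seq T)).

Lemma fpath_restart z z' x y s q : z' y = z x -> {in s, z =1 z'} ->
  fpath z x (rcons s q) -> fpath z' y (rcons s q).
Proof.
case: s => [|w s] zy agree /=; first by rewrite !andbT zy.
case/andP=> /eqP zx ps; rewrite zy zx eqxx /=; apply: etrans ps.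
by apply/esym/eq_in_fpath => u; rewrite belast_rcons => su; apply: agree.
Qed.

(** A 3-cycle through three points of a cycle z, taken in the right orientation,
    only exchanges two of the three arcs that they cut, and leaves a single
    cycle. *)
Lemma fcycle_tperm2 z x p q A B C (s := x :: A ++ p :: B ++ q :: C) :
  uniq s -> fcycle z s ->
  fcycle (tperm x p * tperm x q * z) (x :: B ++ q :: A ++ p :: C).
Proof.
move=> us; have : uniq (x :: p :: q :: A ++ B ++ C).
  by rewrite -(perm_uniq (s1 := s)) //; rewrite /s; perm_count.
rewrite !cons_uniq !in_cons !mem_cat !negb_or -!andbA.
case/and5P=> xp xq xA xB /and5P[xC pq pA pB /and5P[pC qA qB qC _]].
rewrite /s /= !rcons_cat /= !rcons_cat /= -!cat_rcons !cat_path !last_rcons.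
case/and3P=> cA cB cC.
set z' := _ * z.
have z'x : z' x = z p by rewrite !permM tpermL tpermD // eq_sym.
have z'p : z' p = z q by rewrite !permM tpermR tpermL.
have z'q : z' q = z x by rewrite !permM (tpermD xq pq) tpermR.
have z'y y : y != x -> y != p -> y != q -> z y = z' y.
  by move=> yx yp yq; rewrite !permM !tpermD // eq_sym.
have ne (s1 s2 : seq T) y w : y \in s1 -> w \notin s1 -> y != w.
  by move=> sy; apply: contraNneq => <-.
apply/and3P; split.
- by apply: fpath_restart cB => // y By; apply: z'y; apply: (ne B) By _.
- by apply: fpath_restart cA => // y Ay; apply: z'y; apply: (ne A) Ay _.
- by apply: fpath_restart cC => // y Cy; apply: z'y; apply: (ne C) Cy _.
Qed.


(** The two products of transpositions are the two orientations of the 3-cycle on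
    x, p and q; the one that suits the cyclic order of these points keeps a
    single cycle. *)
Lemma cycle_decomp_tperm2 z x p q Z :
    cycle_decomp z [:: Z] -> x \in Z -> p \in Z -> q \in Z -> uniq [:: x; p; q] ->
  exists2 Z', perm_eq Z' Z &
    cycle_decomp (tperm x p * tperm x q * z) [:: Z'] \/
    cycle_decomp (tperm x q * tperm x p * z) [:: Z'].
Proof.
move=> dZ xZ pZ qZ; have [s pZs {}dZ] := cycle_decomp_rot_to dZ xZ.
rewrite /= !inE negb_or -!andbA => /and4P[xp xq pq _].
move: pZ qZ; rewrite !(perm_mem pZs) !inE.
rewrite (eq_sym p x) (eq_sym q x) (negPf xp) (negPf xq) /= => ps qs.
have key p' q' A B C : s = A ++ p' :: B ++ q' :: C ->
    p' != x -> q' != x ->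
    exists2 Z', perm_eq Z' Z & cycle_decomp (tperm x p' * tperm x q' * z) [:: Z'].
  move=> def_s xp' xq'; exists (x :: B ++ q' :: A ++ p' :: C).
    by rewrite perm_sym (perm_trans pZs) // def_s; perm_count.
  have [/= uZ cZ fZ] := dZ; rewrite cats0 def_s in uZ; rewrite def_s andbT in cZ.
  have pf : perm_eq (x :: B ++ q' :: A ++ p' :: C) (x :: A ++ p' :: B ++ q' :: C).
    by perm_count.
  have flat1 (w : seq T) : flatten [:: w] = w by rewrite /= cats0.
  split; first by rewrite flat1 (perm_uniq pf).
    by rewrite /all andbT; apply: fcycle_tperm2.
  move=> y; rewrite flat1 (perm_mem pf) -def_s => yZ.
  have [yx yp yq] : [/\ x != y, p' != y & q' != y].
    by split; apply: contraNneq yZ => <-; rewrite def_s !(inE, mem_cat) eqxx ?orbT.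
  by rewrite !permM !tpermD // fZ // cats0.
case/splitPr: ps key qs => A C key; rewrite mem_cat inE eq_sym (negPf pq) /=.
case/orP=> [/splitPr E|/splitPr E].
  case: E key => A1 A2 key; have [|||Z' pZ' dZ'] := key q p A1 A2 C; rewrite 1?eq_sym //.
    by rewrite -catA.
  by exists Z' => //; right.
case: E key => C1 C2 key; have [|||Z' pZ' dZ'] := key p q A C1 C2; rewrite 1?eq_sym //.
by exists Z' => //; left.
Qed.

(** The permutation al of the points of S has a base cycle of length a through x;
    the lengths sa of its other cycles matter only up to order. *)
Definition marked_decomp al S x a sa := exists A L,
  [/\ cycle_decomp al (A :: L), perm_eq (flatten (A :: L)) S, size A = a,
      perm_eq (shape L) sa & x \in A].

(** A second marked point y allows growing a cycle other than the base cycle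
    without losing track of x. *)
Definition marked2_decomp al S x a y d sa := exists A D L,
  [/\ cycle_decomp al (A :: D :: L), perm_eq (flatten (A :: D :: L)) S,
      size A = a /\ size D = d, perm_eq (shape L) sa & x \in A /\ y \in D].

Lemma marked_decomp_perm al S S' x a sa : perm_eq S S' ->
  marked_decomp al S x a sa -> marked_decomp al S' x a sa.
Proof. by move=> pS [A [L [? ? ? ? ?]]]; exists A, L; split=> //; apply: perm_trans pS. Qed.

Lemma marked_decomp_shape al S x a sa sa' : perm_eq sa sa' ->
  marked_decomp al S x a sa -> marked_decomp al S x a sa'.
Proof. by move=> pS [A [L [? ? ? ? ?]]]; exists A, L; split=> //; apply: perm_trans pS. Qed.

Lemma marked_decomp_uniq al S x a sa : marked_decomp al S x a sa -> uniq S.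
Proof. by case=> A [L [[uL _ _] pS _ _ _]]; rewrite -(perm_uniq pS). Qed.

Lemma marked_decomp_mem al S x a sa : marked_decomp al S x a sa -> x \in S.
Proof. by case=> A [L [_ pS _ _ Ax]]; rewrite -(perm_mem pS) mem_cat Ax. Qed.

Lemma marked_decomp_fix al S x a sa p : marked_decomp al S x a sa ->
  p \notin S -> al p = p.
Proof. by case=> A [L [[_ _ fL] pS _ _ _]]; rewrite -(perm_mem pS); apply: fL. Qed.

Lemma marked2_decompC al S x a y d sa :
  marked2_decomp al S x a y d sa -> marked2_decomp al S y d x a sa.
Proof.
have pC (A D : seq T) L : perm_eq (A :: D :: L) (D :: A :: L).
  by apply/seq.permP => u /=; rewrite addnCA.
case=> A [D [L [dL pS [sA sD] pL [Ax Dy]]]]; exists D, A, L; split=> //.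
  exact: cycle_decomp_perm dL (pC _ _ _).
by apply: perm_trans pS; apply: perm_flatten; apply: pC.
Qed.

Lemma marked_decomp_other al S x a d sa : marked_decomp al S x a (d :: sa) ->
  0 < d -> exists2 y, y \in S & marked2_decomp al S x a y d sa.
Proof.
case=> A [L [dL pS sA pL Ax]] d_gt0.
have : d \in shape L by rewrite (perm_mem pL) mem_head.
case/mapP => D LD sD; have pD := perm_to_rem LD.
case: D sD LD pD => [|y D] sD LD pD; first by rewrite sD in d_gt0.
have pL' : perm_eq (A :: L) [:: A, (y :: D) & rem (y :: D) L] by rewrite perm_cons.
exists y.
  rewrite -(perm_mem pS) /= mem_cat; apply/orP; right; apply/flattenP.
  by exists (y :: D); rewrite ?mem_head.
exists A, (y :: D), (rem (y :: D) L); split; rewrite ?mem_head //.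
- exact: cycle_decomp_perm dL pL'.
- by apply: perm_trans pS; rewrite perm_sym; apply: perm_flatten.
- rewrite -(perm_cons d) {1}sD; apply: perm_trans pL.
  by rewrite perm_sym; apply: (perm_map size pD).
Qed.

Lemma marked2_decompW al S x a y d sa :
  marked2_decomp al S x a y d sa -> marked_decomp al S x a (d :: sa).
Proof.
case=> A [D [L [dL pS [sA sD] pL [Ax Dy]]]]; exists A, (D :: L); split=> //=.
by rewrite sD perm_cons.
Qed.

(** Left and right multiplication by a transposition share all their consequences
    through this property. *)
Definition inserts al be x p := forall C L,
    cycle_decomp al (C :: L) -> x \in C -> p \notin flatten (C :: L) ->
  exists2 C', perm_eq C' (p :: C) & cycle_decomp be (C' :: L).

Lemma marked_decomp_grow al be S x a sa p : inserts al be x p ->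
  marked_decomp al S x a sa -> p \notin S -> marked_decomp be (p :: S) x a.+1 sa.
Proof.
move=> ins [A [L [dL pS sA pL Ax]]] pnS; rewrite -(perm_mem pS) in pnS.
have [A' pA' dL'] := ins _ _ dL Ax pnS.
exists A', L; split=> //=.
- by apply: (@perm_trans _ ((p :: A) ++ flatten L)); rewrite ?perm_cat2r ?perm_cons.
- by rewrite (perm_size pA') /= sA.
- by rewrite (perm_mem pA') inE Ax orbT.
Qed.

Lemma marked2_decomp_grow al be S x a y d sa p : inserts al be x p ->
    marked2_decomp al S x a y d sa -> p \notin S ->
  marked2_decomp be (p :: S) x a.+1 y d sa.
Proof.
move=> ins [A [D [L [dL pS [sA sD] pL [Ax Dy]]]]] pnS; rewrite -(perm_mem pS) in pnS.
have [A' pA' dL'] := ins _ _ dL Ax pnS.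
exists A', D, L; split=> //.
- by apply: (@perm_trans _ ((p :: A) ++ flatten (D :: L))); rewrite ?perm_cat2r ?perm_cons.
- by rewrite (perm_size pA') /= sA.
- by rewrite (perm_mem pA') inE Ax orbT.
Qed.

Lemma marked_decomp_growl al S x a sa p : marked_decomp al S x a sa ->
  p \notin S -> marked_decomp (tperm x p * al) (p :: S) x a.+1 sa.
Proof. by apply: marked_decomp_grow => C L; apply: cycle_decomp_insertl. Qed.

Lemma marked_decomp_growr al S x a sa p : marked_decomp al S x a sa ->
  p \notin S -> marked_decomp (al * tperm x p) (p :: S) x a.+1 sa.
Proof. by apply: marked_decomp_grow => C L; apply: cycle_decomp_insertr. Qed.

Lemma marked2_decomp_growl al S x a y d sa p : marked2_decomp al S x a y d sa ->
  p \notin S -> marked2_decomp (tperm x p * al) (p :: S) x a.+1 y d sa.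
Proof. by apply: marked2_decomp_grow => C L; apply: cycle_decomp_insertl. Qed.

Lemma marked2_decomp_growr al S x a y d sa p : marked2_decomp al S x a y d sa ->
  p \notin S -> marked2_decomp (al * tperm x p) (p :: S) x a.+1 y d sa.
Proof. by apply: marked2_decomp_grow => C L; apply: cycle_decomp_insertr. Qed.

Lemma marked_decomp_add al S x a sa p : marked_decomp al S x a sa ->
  p \notin S -> marked_decomp al (p :: S) x a (1%N :: sa).
Proof.
case=> A [L [dL pS sA pL Ax]] pnS; rewrite -(perm_mem pS) in pnS.
exists A, ([:: p] :: L); split=> //=.
- apply: (cycle_decomp_perm (cycle_decomp_add dL pnS)).
  by apply/seq.permP => u /=; rewrite addnCA.
- by apply: perm_trans (permEl (perm_catCA A [:: p] _)) _; rewrite perm_cons.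
- by rewrite perm_cons.
Qed.

Lemma marked_decomp_remove1 al S x a sa : marked_decomp al S x a (1%N :: sa) ->
  exists p S', [/\ perm_eq S (p :: S'), p \notin S' & marked_decomp al S' x a sa].
Proof.
move=> dal; have uS := marked_decomp_uniq dal.
have [//|p Sp /marked2_decompC[D [A [L [dL pS [sD sA] pL [Dp Ax]]]]]] :=
  marked_decomp_other dal.
move: D sD Dp dL pS => [|p' [|? ?]] //= _; rewrite inE => /eqP <- dL pS.
exists p, (flatten (A :: L)); split; first by rewrite perm_sym.
  by case: dL => /=/andP[].
by exists A, L; split=> //; apply: cycle_decomp_drop dL.
Qed.

Lemma marked_decompV al S x a sa :
  marked_decomp al S x a sa -> marked_decomp al^-1 S x a sa.
Proof.
case=> A [L [dL pS sA pL Ax]]; exists (rev A), (map rev L).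
split; rewrite ?size_rev ?mem_rev //.
- exact: (cycle_decompV dL).
- exact: perm_trans (perm_flatten_rev (A :: L)) pS.
- by rewrite shape_map_rev.
Qed.

(** The product Z is called the hub: every point lies on it, so that a point of any
    cycle of al or ga can be used to enlarge it.  The point x common to the two
    base cycles is needed later to enlarge them together with the product. *)
Definition hub S a sa c sc := exists al ga x Z,
  [/\ marked_decomp al S x a sa, marked_decomp ga S x c sc,
      cycle_decomp (al * ga) [:: Z] & perm_eq Z S].

Lemma hub_sym S a sa c sc : hub S a sa c sc -> hub S c sc a sa.
Proof.
case=> al [ga [x [Z [dal dga dz pZ]]]]; exists ga^-1, al^-1, x, (rev Z).
split; [exact: marked_decompV | exact: marked_decompV | | by rewrite perm_rev].
by rewrite -invMg; apply: (cycle_decompV dz).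
Qed.

Lemma hub_shape S a sa sa' c sc sc' : perm_eq sa sa' -> perm_eq sc sc' ->
  hub S a sa c sc -> hub S a sa' c sc'.
Proof.
move=> psa psc [al [ga [x [Z [dal dga dz pZ]]]]]; exists al, ga, x, Z; split=> //.
  exact: marked_decomp_shape dal.
exact: marked_decomp_shape dga.
Qed.

(** In the graph whose vertices are the cycles and whose edges are the points, p is
    a new edge that ends in a leaf. *)
Lemma hub_leaf_base S a sa c sc p : hub S a sa c sc -> p \notin S ->
  hub (p :: S) a (1%N :: sa) c.+1 sc.
Proof.
move=> [al [ga [x [Z [dal dga dz pZ]]]]] pnS.
have xZ : x \in Z by rewrite (perm_mem pZ) (marked_decomp_mem dal).
have [|Z' pZ' dz'] := cycle_decomp_insertr (p := p) dz xZ.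
  by rewrite /= cats0 (perm_mem pZ).
exists al, (ga * tperm x p), x, Z'; split.
- exact: marked_decomp_add.
- exact: marked_decomp_growr.
- by rewrite mulgA.
- by apply: perm_trans pZ' _; rewrite perm_cons.
Qed.

Lemma hub_leaf_other S a sa c d sc p : hub S a sa c (d :: sc) -> p \notin S ->
  0 < d -> hub (p :: S) a (1%N :: sa) c (d.+1 :: sc).
Proof.
move=> [al [ga [x [Z [dal dga dz pZ]]]]] pnS d_gt0.
have [y yS dga2] := marked_decomp_other dga d_gt0.
have yZ : y \in Z by rewrite (perm_mem pZ).
have [|Z' pZ' dz'] := cycle_decomp_insertr (p := p) dz yZ.
  by rewrite /= cats0 (perm_mem pZ).
exists al, (ga * tperm y p), x, Z'; split.
- exact: marked_decomp_add.
- by apply: marked2_decompW; apply: marked2_decompC;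
     apply: marked2_decomp_growr => //; apply: marked2_decompC.
- by rewrite mulgA.
- by apply: perm_trans pZ' _; rewrite perm_cons.
Qed.

(** The 3-cycle on y, p, q is put between al and its left end: it inserts p and q
    into the cycle of y whichever its orientation, and the orientation is chosen
    so that the hub remains a single cycle. *)
Lemma hub_merge_at S S2 al ga x y Z p q a sa c sc :
    cycle_decomp (al * ga) [:: Z] -> perm_eq Z S -> uniq S ->
    perm_eq S [:: p, q & S2] -> y \in S2 -> marked_decomp ga S x c sc ->
    (forall p' q', p' != q' -> p' \notin S2 -> q' \notin S2 ->
       marked_decomp (tperm y p' * (tperm y q' * al)) [:: p', q' & S2] x a sa) ->
  hub S a sa c sc.
Proof.
move=> dz pZ uS pS yS2 dga grow.
have /and4P[] : [&& p != q, p \notin S2, q \notin S2 & uniq [:: y; p; q]].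
  move: uS; rewrite (perm_uniq pS) /= !inE !negb_or -!andbA => /and4P[pq pS2 qS2 _].
  by rewrite pq pS2 qS2 /= !andbT; apply/andP; split; apply: contraTneq yS2 => ->.
move=> pq pS2 qS2 uypq.
have [yZ pZ' qZ] : [/\ y \in Z, p \in Z & q \in Z].
  by rewrite !(perm_mem pZ) !(perm_mem pS) !inE !eqxx yS2 !orbT.
have [Z' pZ'' dz'] := cycle_decomp_tperm2 dz yZ pZ' qZ uypq.
have pZS := perm_trans pZ'' pZ.
case: dz' => dz'; rewrite -mulgA in dz'.
  exists (tperm y p * (tperm y q * al)), ga, x, Z'; split; rewrite -?mulgA //.
  by apply: marked_decomp_perm (grow p q pq pS2 qS2); rewrite perm_sym.
exists (tperm y q * (tperm y p * al)), ga, x, Z'; split; rewrite -?mulgA //.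
rewrite eq_sym in pq; apply: marked_decomp_perm (grow q p pq qS2 pS2).
by rewrite perm_sym (permPr (permEl (perm_catCA [:: q] [:: p] S2))).
Qed.

Lemma hub_merge_base S a sa c sc : hub S a (1%N :: 1%N :: sa) c sc ->
  hub S a.+2 sa c sc.
Proof.
move=> [al [ga [x [Z [dal dga dz pZ]]]]].
have [p [S1 [pS1 pnS dal1]]] := marked_decomp_remove1 dal.
have [q [S2 [pS2 qnS dal2]]] := marked_decomp_remove1 dal1.
have pS : perm_eq S [:: p, q & S2] by rewrite (perm_trans pS1) // perm_cons.
apply: (hub_merge_at dz pZ (marked_decomp_uniq dal) pS (marked_decomp_mem dal2) dga).
move=> p' q' pq pn qn.
apply: marked_decomp_growl; first exact: marked_decomp_growl.
by rewrite inE negb_or pq.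
Qed.

Lemma hub_merge_other S a d sa c sc : hub S a (1%N :: 1%N :: d :: sa) c sc ->
  0 < d -> hub S a (d.+2 :: sa) c sc.
Proof.
move=> [al [ga [x [Z [dal dga dz pZ]]]]] d_gt0.
have [p [S1 [pS1 pnS dal1]]] := marked_decomp_remove1 dal.
have [q [S2 [pS2 qnS dal2]]] := marked_decomp_remove1 dal1.
have [y yS2 /marked2_decompC dy] := marked_decomp_other dal2 d_gt0.
have pS : perm_eq S [:: p, q & S2] by rewrite (perm_trans pS1) // perm_cons.
apply: (hub_merge_at dz pZ (marked_decomp_uniq dal) pS yS2 dga).
move=> p' q' pq pn qn; apply: marked2_decompW; apply: marked2_decompC.
apply: marked2_decomp_growl; first exact: marked2_decomp_growl.
by rewrite inE negb_or pq.
Qed.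

End Hub.

(** * Cycle types whose product can be a full cycle *)

Section HubExists.
Local Open Scope group_scope.
Variable T : finType.
Implicit Types (al be ga z : {perm T}) (A B C S X Y Z : seq T) (L : seq (seq T)).

Lemma perm_has_cons (P : pred nat) s : has P s ->
  exists2 d, P d & exists s', perm_eq s (d :: s').
Proof. by case/hasP => d sd Pd; exists d => //; exists (rem d s); apply: perm_to_rem. Qed.

Lemma sumn_ge (s : seq nat) m : all (fun d => m <= d) s -> m * size s <= sumn s.
Proof. by elim: s => [|d s IH] /=; [lia | case/andP=> ? /IH; lia]. Qed.

Lemma sumn_le (s : seq nat) m : ~~ has (fun d => m < d) s -> sumn s <= m * size s.
Proof. by elim: s => [|d s IH] /=; [lia | rewrite negb_or => /andP[? /IH]; lia]. Qed.

(** Only the number of points matters; quantifying over all point sets is what makes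
    the inductions on cycle types work. *)
Definition hub_for a sa c sc := forall S, uniq S -> size S = (a + sumn sa)%N ->
  hub S a sa c sc.

Lemma hub_for_sym a sa c sc : (a + sumn sa = c + sumn sc)%N ->
  hub_for a sa c sc -> hub_for c sc a sa.
Proof. by move=> eqn h S uS sS; apply: hub_sym; apply: h; rewrite // sS. Qed.

Lemma hub_for_shape a sa sa' c sc sc' : perm_eq sa sa' -> perm_eq sc sc' ->
  hub_for a sa c sc -> hub_for a sa' c sc'.
Proof.
move=> pa pc h S uS sS; apply: (hub_shape pa pc); apply: h => //.
by rewrite sS (perm_sumn pa).
Qed.

Lemma hub_for_leaf_base a sa c sc : hub_for a sa c sc ->
  hub_for a (1%N :: sa) c.+1 sc.
Proof.
move=> h [|p S] /= uS; first by lia.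
move: uS => /andP[pS uS] sS; apply: hub_leaf_base => //; apply: h => //; lia.
Qed.

Lemma hub_for_leaf_other a sa c d sc : hub_for a sa c (d :: sc) -> 0 < d ->
  hub_for a (1%N :: sa) c (d.+1 :: sc).
Proof.
move=> h d_gt0 [|p S] /= uS; first by lia.
move: uS => /andP[pS uS] sS; apply: hub_leaf_other => //; apply: h => //; lia.
Qed.

Lemma hub_for_merge_base a sa c sc : hub_for a (1%N :: 1%N :: sa) c sc ->
  hub_for a.+2 sa c sc.
Proof.
by move=> h S uS sS; apply: hub_merge_base; apply: h => //=; rewrite sS; lia.
Qed.

Lemma hub_for_merge_other a d sa c sc : hub_for a (1%N :: 1%N :: d :: sa) c sc ->
  0 < d -> hub_for a (d.+2 :: sa) c sc.
Proof.
move=> h d_gt0 S uS sS; apply: hub_merge_other => //; apply: h => //=; rewrite sS /=; lia.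
Qed.

Lemma cycle_decomp_1 x : cycle_decomp (1 : {perm T}) [:: [:: x]].
Proof. by split=> [||y _]; rewrite /= ?perm1 ?eqxx. Qed.

Lemma hub_for_1 : hub_for 1 [::] 1 [::].
Proof.
move=> [|x [|? ?]] // _ _.
have m1 : marked_decomp (1 : {perm T}) [:: x] x 1 [::].
  by exists [:: x], [::]; split; rewrite ?mem_head //; apply: cycle_decomp_1.
by exists 1, 1, x, [:: x]; split=> //; rewrite mulg1; apply: cycle_decomp_1.
Qed.

(** The tree case.  If no cycle other than the base cycles is a fixed point, counting
    points shows that both base cycles have length 1, which is excluded as soon as
    there are two points: x would be isolated.  Otherwise remove a leaf. *)
Lemma hub_planar N a sa c sc :
    (a + sumn sa = N -> c + sumn sc = N -> 0 < a -> 0 < c ->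
    all (leq 1) sa -> all (leq 1) sc -> (size sa + size sc).+1 = N ->
    (N == 1) || (2 < a + c) -> hub_for a sa c sc)%N.
Proof.
elim: N a sa c sc => [|N IH] a sa c sc; first by lia.
have [->|N_gt0] := posnP N.
  move=> sumA sumC a_gt0 c_gt0 pA pC sz _; have [sza szc] : size sa = 0 /\ size sc = 0 by lia.
  by move: sumA sumC; rewrite (size0nil sza) (size0nil szc) /= !addn0 => -> ->; apply: hub_for_1.
have leaf a' sa' c' sc' : (a' + sumn sa' = N.+1 -> c' + sumn sc' = N.+1 -> 0 < a' -> 0 < c' ->
    all (leq 1) sa' -> all (leq 1) sc' -> (size sa' + size sc').+1 = N.+1 ->
    2 < a' + c' -> has (pred1 1%N) sa' -> hub_for a' sa' c' sc')%N.
  move=> sumA sumC a_gt0 c_gt0 pA pC sz ac /perm_has_cons[_ /eqP-> [sa2 pS]].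
  apply: (hub_for_shape (sa := 1%N :: sa2) (sc := sc')); rewrite 1?perm_sym //.
  move: pA sumA sz; rewrite (perm_all _ pS) (perm_sumn pS) (perm_size pS) /= => pA sumA sz.
  have [/perm_has_cons[[|d] d2 [sc2 pS2]]|no2] := boolP (has (leq 2) sc') => //.
    apply: (hub_for_shape (sa := 1%N :: sa2) (sc := d.+1 :: sc2)); rewrite 1?perm_sym //.
    move: pC sumC sz; rewrite (perm_all _ pS2) (perm_sumn pS2) (perm_size pS2) /= => pC sumC sz.
    by apply: hub_for_leaf_other => //; apply: IH => //=; lia.
  have := sumn_le no2; case: c' c_gt0 sumC ac => // c' _ sumC ac le2.
  have nil0 : 0 < size sa2 \/ sumn sa2 = 0 by case: (sa2) => [|? ?]; [right | left].
  by apply: hub_for_leaf_base; apply: IH => //; lia.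
move=> sumA sumC a_gt0 c_gt0 pA pC sz ac; have {}ac : (2 < a + c)%N by lia.
have [sa1|nsa1] := boolP (has (pred1 1%N) sa); first exact: leaf.
have [sc1|nsc1] := boolP (has (pred1 1%N) sc).
  by apply: hub_for_sym; [lia | apply: leaf => //; lia].
have ge2 s : all (leq 1) s -> ~~ has (pred1 1%N) s -> (2 * size s <= sumn s)%N.
  move=> ps ns; apply: sumn_ge; apply/allP => -[|[|d]] // sd; last by case/hasP: ns; exists 1%N.
  by have /allP/(_ _ sd) := ps.
have := ge2 _ pA nsa1; have := ge2 _ pC nsc1; lia.
Qed.

(** The number g is the genus of the product.  A positive genus leaves room for a
    cycle of length at least 3; splitting off two fixed points lowers g by one, and
    the merging operations restore the cycle. *)
Theorem hub_exists g a sa c sc :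
    (a + sumn sa = c + sumn sc -> 0 < a -> 0 < c ->
    all (leq 1) sa -> all (leq 1) sc ->
    (size sa + size sc).+1 + g.*2 = a + sumn sa ->
    (a + sumn sa == 1) || (2 < a + c) -> hub_for a sa c sc)%N.
Proof.
elim: g a sa c sc => [|g IH] a sa c sc sumAC a_gt0 c_gt0 pA pC sz ac.
  by apply: (@hub_planar (a + sumn sa)) => //; lia.
have other a' sa' c' sc' : (a' + sumn sa' = c' + sumn sc' -> 0 < a' -> 0 < c' ->
    all (leq 1) sa' -> all (leq 1) sc' ->
    (size sa' + size sc').+1 + g.+1.*2 = a' + sumn sa' -> 2 < a' + c' ->
    has (leq 3) sa' -> hub_for a' sa' c' sc')%N.
  move=> {}sumAC {}a_gt0 {}c_gt0 {}pA {}pC {}sz {}ac.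
  case/perm_has_cons=> -[|[|d]] // d_gt0 [sa2 pS].
  apply: (hub_for_shape (sa := d.+2 :: sa2) (sc := sc')); rewrite 1?perm_sym //.
  move: pA sumAC sz; rewrite (perm_all _ pS) (perm_sumn pS) (perm_size pS) /= => pA sumAC sz.
  by apply: hub_for_merge_other => //; apply: IH; rewrite //= ?pA ?andbT; lia.
have base a' sa' c' sc' : (a' + sumn sa' = c' + sumn sc' -> 0 < c' ->
    all (leq 1) sa' -> all (leq 1) sc' ->
    (size sa' + size sc').+1 + g.+1.*2 = a' + sumn sa' -> 4 < a' + c' ->
    2 < a' -> hub_for a' sa' c' sc')%N.
  case: a' => [|[|a']] // {}sumAC {}c_gt0 {}pA {}pC {}sz {}ac a_gt2.
  by apply: hub_for_merge_base => //; apply: IH; rewrite //= ?pA; lia.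
have {}ac : (2 < a + c)%N by lia.
have [sa3|nsa3] := boolP (has (leq 3) sa); first exact: other.
have [sc3|nsc3] := boolP (has (leq 3) sc).
  by apply: hub_for_sym; [lia | apply: other => //; lia].
have := sumn_le nsa3; have := sumn_le nsc3 => leC leA.
have [a_gt2|a_le2] := ltnP 2 a; first by apply: base => //; lia.
by apply: hub_for_sym; [lia | apply: base => //; lia].
Qed.

End HubExists.

(** * A 7-cycle that controls parities *)

Ltac neq_side := first [assumption | rewrite eq_sym; assumption].

(** Evaluates products of transpositions at points whose pairwise distinctness is
    known. *)
Ltac eval_tperm := rewrite ?permM; repeat match goal with
  | |- context [fun_of_perm (tperm ?a ?b) ?a] => rewrite (tpermL a b)
  | |- context [fun_of_perm (tperm ?a ?b) ?b] => rewrite (tpermR a b)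
  | |- context [fun_of_perm (tperm ?a ?b) ?c] =>
      is_var c; rewrite (@tpermD _ a b c ltac:(neq_side) ltac:(neq_side))
  end; try reflexivity.

Section Parities.
Local Open Scope group_scope.
Variable T : finType.
Implicit Types (al be ga z : {perm T}) (A B C S X Y Z : seq T) (L : seq (seq T)).

Section SevenCycle.
Variables (x p1 p2 p3 p4 p5 p6 : T).
Hypothesis uxp : uniq [:: x; p1; p2; p3; p4; p5; p6].

(** Written as a product of transpositions with x, the 7-cycle x, p1, ..., p6 is
    inserted into the cycle of x by six successive insertions. *)
Definition seven_cycle := tperm x p1 * tperm x p2 * tperm x p3 * tperm x p4 *
  tperm x p5 * tperm x p6.

Let r := seven_cycle.

(** Multiplication by 3 on the residues modulo 7, with p_i standing for i and x for
    0; it is a 6-cycle since 3 is a primitive root. *)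
Definition cubing_conjugator := tperm p1 p3 * tperm p1 p2 * tperm p1 p6 * tperm p1 p4 *
  tperm p1 p5.

Let w := cubing_conjugator.

Lemma seven_cycleE : [/\ r x = p1, r p1 = p2, r p2 = p3, r p3 = p4 &
  [/\ r p4 = p5, r p5 = p6, r p6 = x & forall y,
    y \notin [:: x; p1; p2; p3; p4; p5; p6] -> r y = y]].
Proof.
move: uxp; rewrite /= !inE !negb_or -?andbA.
case/and5P=> x1 x2 x3 x4 /and5P[x5 x6 p12 p13 /and5P[p14 p15 p16 p23]].
case/and5P=> p24 p25 p26 p34 /and5P[p35 p36 p45 p46 /andP[p56 _]].
rewrite /r /seven_cycle; split; last split; try by eval_tperm.
move=> y; rewrite !inE !negb_or -?andbA => /and5P[? ? ? ? /and3P[? ? ?]].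
by eval_tperm.
Qed.

Lemma cubing_conjugatorE : [/\ w p1 = p3, w p2 = p6, w p3 = p2, w p4 = p5 &
  [/\ w p5 = p1, w p6 = p4 & forall y, y \notin [:: p1; p2; p3; p4; p5; p6] -> w y = y]].
Proof.
move: uxp; rewrite /= !inE !negb_or -?andbA.
case/and5P=> x1 x2 x3 x4 /and5P[x5 x6 p12 p13 /and5P[p14 p15 p16 p23]].
case/and5P=> p24 p25 p26 p34 /and5P[p35 p36 p45 p46 /andP[p56 _]].
rewrite /w /cubing_conjugator; split; last split; try by eval_tperm.
move=> y; rewrite !inE !negb_or -?andbA => /and5P[? ? ? ? /andP[? ?]].
by eval_tperm.
Qed.

Lemma odd_seven_cycle : odd_perm r = false.
Proof.
move: uxp; rewrite /= !inE !negb_or -?andbA.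
case/and5P=> x1 x2 x3 x4 /and3P[x5 x6 _].
by rewrite /r /seven_cycle !odd_permM !odd_tperm x1 x2 x3 x4 x5 x6.
Qed.

Lemma odd_cubing_conjugator : odd_perm w = true.
Proof.
move: uxp; rewrite /= !inE !negb_or -?andbA.
case/and5P=> _ _ _ _ /and5P[_ _ p12 p13 /and4P[p14 p15 p16 _]].
by rewrite /w /cubing_conjugator !odd_permM !odd_tperm p12 p13 p14 p15 p16.
Qed.

Lemma seven_cycle_expg7 : r ^+ 7 = 1.
Proof.
have [rx r1 r2 r3 [r4 r5 r6 ry]] := seven_cycleE.
apply/perm.permP => y; rewrite permX perm1.
have [|/ry] := boolP (y \in [:: x; p1; p2; p3; p4; p5; p6]).
  by rewrite !inE; do 6?[case/predU1P=> [->|]]; last move=> /eqP ->;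
    rewrite /= ?(rx, r1, r2, r3, r4, r5, r6).
by move=> eqy; rewrite /= !eqy.
Qed.

Lemma seven_cycleJ : r ^ w = r ^+ 3.
Proof.
have [rx r1 r2 r3 [r4 r5 r6 ry]] := seven_cycleE.
have [w1 w2 w3 w4 [w5 w6 wy]] := cubing_conjugatorE.
have wx : w x = x by apply: wy; case/andP: uxp.
apply/perm.permP => y; rewrite -(permKV w y) permJ permX.
move: (w^-1 y) => {}y; have [|/[dup] ysx /ry eqy] := boolP (y \in [:: x; p1; p2; p3; p4; p5; p6]).
  by rewrite !inE; do 6?[case/predU1P=> [->|]]; last move=> /eqP ->;
    rewrite /= ?(rx, r1, r2, r3, r4, r5, r6, w1, w2, w3, w4, w5, w6, wx).
by rewrite eqy wy /= ?eqy //; move: ysx; rewrite inE negb_or => /andP[].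
Qed.

Lemma seven_cycleJX j : r ^ (w ^+ j) = r ^+ (3 ^ j)%N.
Proof.
elim: j => [|j IH]; first by rewrite expg0 conjg1 expg1.
by rewrite expgSr conjgM IH conjXg seven_cycleJ -expgM expnS.
Qed.

(** Modulo 7 the even powers of 3 are 1, 2, 4 and the odd ones are 3, 5, 6.  The sums
    1 + 2 + 4 and 1 + 1 + 5, permuted and negated, realize all parities.  Modulo 5
    three nonzero squares never add up to 0, so 7 is the least suitable prime. *)
Lemma cubic_powers_sum_mod7 (d1 d2 d3 : bool) : exists j1 j2 j3 : nat,
  [/\ odd j1 = d1, odd j2 = d2, odd j3 = d3 & 7 %| (3 ^ j1 + 3 ^ j2 + 3 ^ j3)%N].
Proof.
case: d1 d2 d3 => [] [] [].
- by exists 1%N, 3, 5.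
- by exists 3, 3, 2.
- by exists 3, 2, 3.
- by exists 5, 0, 0.
- by exists 2, 3, 3.
- by exists 0, 5, 0.
- by exists 0, 0, 5.
- by exists 0, 2, 4.
Qed.

(** With e = r ^ (3 ^ j1) and f = r ^ - (3 ^ j3), the three factors are a e, e^-1 b f
    and f^-1 c.  Conjugation by e or f, both even, turns them into a, b, c times
    r ^ (3 ^ j1), r ^ (3 ^ j2) and r ^ (3 ^ j3), by the congruence on the
    exponents. *)
Lemma prescribed_parities (a b c : {perm T}) (d1 d2 d3 : bool) :
    {in [:: p1; p2; p3; p4; p5; p6], a =1 id} ->
    {in [:: p1; p2; p3; p4; p5; p6], b =1 id} ->
    {in [:: p1; p2; p3; p4; p5; p6], c =1 id} ->
  exists g1 g2 g3 : {perm T},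
    [/\ odd_perm g1 = d1, odd_perm g2 = d2, odd_perm g3 = d3 &
        (a * r) ^ g1 * (b * r) ^ g2 * (c * r) ^ g3 = a * b * c].
Proof.
move=> fa fb fc; have [j1 [j2 [j3 [<- <- <- dvd7]]]] := cubic_powers_sum_mod7 d1 d2 d3.
have odd_wX j : odd_perm (w ^+ j) = odd j.
  by elim: j => [|j IH]; rewrite ?odd_perm1 // expgS odd_permM IH odd_cubing_conjugator.
have odd_rX j : odd_perm (r ^+ j) = false.
  by elim: j => [|j IH]; rewrite ?odd_perm1 // expgS odd_permM IH odd_seven_cycle.
have wJ (h : {perm T}) j : {in [:: p1; p2; p3; p4; p5; p6], h =1 id} ->
    (h * r) ^ (w ^+ j) = h * r ^+ (3 ^ j)%N.
  move=> fh; rewrite conjMg seven_cycleJX; congr (_ * _).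
  apply/conjg_fixP; apply/commgP; apply: commuteX.
  have [w1 w2 w3 w4 [w5 w6 wy]] := cubing_conjugatorE.
  apply/perm.permP => y; rewrite (permM h) (permM w).
  have [yp|nyp] := boolP (y \in [:: p1; p2; p3; p4; p5; p6]).
    rewrite (fh _ yp) fh //; move: yp; rewrite !inE.
    by do 5?[case/predU1P=> [->|]]; last move=> /eqP ->;
      rewrite ?(w1, w2, w3, w4, w5, w6) ?eqxx ?orbT.
  rewrite (wy y nyp) wy //; apply: contra nyp => hyp.
  by rewrite -(perm_inj (fh _ hyp)).
pose e := r ^+ (3 ^ j1)%N; pose f := (r ^+ (3 ^ j3)%N)^-1.
have ef : r ^+ (3 ^ j2)%N = f * e^-1.
  apply: (mulIg e); rewrite mulgKV; apply: (mulIg (r ^+ (3 ^ j3)%N)); rewrite mulVg.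
  rewrite -!expgD; have /dvdnP[m eqm] : 7 %| (3 ^ j2 + 3 ^ j1 + 3 ^ j3)%N.
    by rewrite (addnC (3 ^ j2)%N).
  by rewrite eqm mulnC expgM seven_cycle_expg7 expg1n.
exists (w ^+ j1), (w ^+ j2 * e), (w ^+ j3 * f).
rewrite !odd_permM odd_permV !odd_wX !odd_rX !addbF; split=> //.
rewrite !conjgM !wJ // ef -/e -[r ^+ (3 ^ j3)%N]invgK -/f !conjgE.
by rewrite !mulgA !(mulgK, mulgKV).
Qed.

End SevenCycle.
End Parities.

(** * Products of two conjugates, with even conjugators *)

Section Products.
Local Open Scope group_scope.
Variable T : finType.
Implicit Types (al be ga z : {perm T}) (A B C S X Y Z : seq T) (L : seq (seq T)).

(** The product of two even permutations is even, so for even n the longest cycle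
    that it can be is an (n-1)-cycle. *)
Definition hub_base n := if odd n then n else n.-1.
Definition hub_rest n := if odd n then [::] else [:: 1%N].

(** For an even number of points, one point is added to a product on an odd number:
    al and ga both grow at x by the same transposition, which cancels in the
    product. *)
Lemma hub_any_parity a sa c sc S : uniq S -> size S = (a + sumn sa)%N ->
    (a + sumn sa = c + sumn sc)%N -> 1 < a -> 2 < c -> all (leq 1) sa -> all (leq 1) sc ->
    ~~ odd (size sa + size sc) -> size sa + size sc + 2 <= size S ->
  exists al ga x, [/\ marked_decomp al S x a sa, marked_decomp ga S x c sc &
    marked_decomp (al * ga) S x (hub_base (size S)) (hub_rest (size S))].
Proof.
rewrite /hub_base /hub_rest => uS sS eqn a_gt1 c_gt2 pA pC evn le_n.
have [oddS|evenS] := boolP (odd (size S)).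
  have [||||al [ga [x [Z [dal dga dz pZ]]]]] :=
      hub_exists (g := ((size S).-1 - (size sa + size sc))./2) eqn _ _ pA pC _ _ uS sS; try lia.
  exists al, ga, x; split=> //; exists Z, [::]; split; rewrite /= ?cats0 //.
    exact: perm_size.
  by rewrite (perm_mem pZ) (marked_decomp_mem dal).
case: S uS sS le_n evenS => [|p S] /=; first by lia.
move=> /andP[pnS uS] sS le_n evenS; case: a a_gt1 sS eqn => // a a_gt0 sS eqn.
case: c c_gt2 eqn => // c c_gt1 eqn.
have [||||||al [ga [x [Z [dal dga dz pZ]]]]] :=
    hub_exists (g := ((size S).-1 - (size sa + size sc))./2) (a := a) (sa := sa) (c := c)
      (sc := sc) _ _ _ pA pC _ _ uS; try lia.
exists (al * tperm x p), (tperm x p * ga), x; split.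
- exact: marked_decomp_growr.
- exact: marked_decomp_growl.
- rewrite mulgA -(mulgA al) tperm2 mulg1; apply: marked_decomp_add => //.
  exists Z, [::]; split; rewrite /= ?cats0 //; first exact: perm_size.
  by rewrite (perm_mem pZ) (marked_decomp_mem dal).
Qed.

Lemma marked_decomp_conj al S x a sa si L : marked_decomp al S x a sa ->
    perm_eq S (enum T) -> full_decomp si L -> perm_eq (shape L) (a :: sa) ->
  exists g, si ^ g = al.
Proof.
case=> A [L' [dal pS sA psa Ax]] pT dsi pL.
have p' : perm_eq (shape L) (shape (A :: L')).
  by apply: perm_trans pL _; rewrite /= sA perm_cons perm_sym.
apply: (full_decomp_conj dsi _ p'); split=> //; first exact: perm_trans pT.
have [_ _ nL] := dsi; have n0 : 0 \notin shape L.
  by apply: contra nL => /mapP[C LC /esym/size0nil <-].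
rewrite (perm_mem p') in n0.
by apply: contra n0 => LA; apply/mapP; exists [::].
Qed.

Lemma marked_decomp_full al S x a sa : marked_decomp al S x a sa ->
    perm_eq S (enum T) -> all (leq 1) sa ->
  exists2 L, full_decomp al L & perm_eq (shape L) (a :: sa).
Proof.
case=> A [L [dal pS sA psa Ax]] pT pos; exists (A :: L).
  split=> //; first exact: perm_trans pT.
  rewrite in_cons negb_or; apply/andP; split; first by apply: contraTneq Ax => <-.
  rewrite -(perm_all _ psa) in pos; apply/negP => nL.
  by have /(allP pos) : 0 \in shape L by apply/mapP; exists [::].
by rewrite /= sA perm_cons.
Qed.

Lemma full_decompV si L : full_decomp si L -> full_decomp si^-1 (map rev L).
Proof.
case=> dL pL nL; split; first exact: cycle_decompV.
  exact: perm_trans (perm_flatten_rev L) pL.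
by apply: contra nL => /mapP[C LC /(congr1 rev)]; rewrite revK ; rewrite /rev /= => ->.
Qed.

Lemma full_decomp_size si L : full_decomp si L -> sumn (shape L) = #|T|.
Proof. by case=> _ pL _; rewrite -size_flatten (perm_size pL) cardE. Qed.

Lemma full_decomp_pos si L : full_decomp si L -> all (leq 1) (shape L).
Proof.
by case=> _ _ nL; apply/allP => _ /mapP[[|y C] LC ->] //; rewrite LC in nL.
Qed.

Lemma full_decomp_odd si L : full_decomp si L -> odd_perm si = odd #|T| (+) odd (size L).
Proof. by move=> dL; rewrite /odd_perm (card_porbits_full_decomp dL). Qed.

(* the type of hub elements *)
Definition hub_type z := exists2 L, full_decomp z L &
  perm_eq (shape L) (hub_base #|T| :: hub_rest #|T|).

(** Here the conjugators are arbitrary; this serves permutations with short cycles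
    only, to which no 7-cycle can be inserted. *)
Lemma hub_factor_conj si ta A C L L' :
    full_decomp si (A :: L) -> full_decomp ta (C :: L') ->
    1 < size A -> 2 < size C -> odd_perm si = odd_perm ta ->
    size L + size L' + 2 <= #|T| ->
  exists g h, hub_type (si ^ g * ta ^ h).
Proof.
move=> dsi dta sA sC par le_n.
have := full_decomp_odd dsi; have := full_decomp_odd dta; rewrite par => -> /= eqo.
have := full_decomp_size dsi; have := full_decomp_size dta => /= sumC sumA.
have /= /andP[_ pA] := full_decomp_pos dsi; have /= /andP[_ pC] := full_decomp_pos dta.
have evn : ~~ odd (size (shape L) + size (shape L')).
  by rewrite !size_map oddD; move: eqo; do 3 case: odd.
have n1 : size (enum T) = (size A + sumn (shape L))%N by rewrite sumA cardE.
have n2 : (size A + sumn (shape L) = size C + sumn (shape L'))%N by rewrite sumA.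
have n3 : size (shape L) + size (shape L') + 2 <= size (enum T) by rewrite n1 sumA !size_map.
have [al [ga [x [dal dga dz]]]] :=
  hub_any_parity (enum_uniq T) n1 n2 sA sC pA pC evn n3.
have [g alg] := marked_decomp_conj dal (perm_refl _) dsi (perm_refl _).
have [h gah] := marked_decomp_conj dga (perm_refl _) dta (perm_refl _).
exists g, h; rewrite alg gah /hub_type cardE.
by apply: marked_decomp_full dz _ _; rewrite ?perm_refl // /hub_rest; case: odd.
Qed.

Lemma seven_cycle_marked al S x a sa p1 p2 p3 p4 p5 p6 :
    marked_decomp al S x a sa -> uniq [:: p1, p2, p3, p4, p5, p6 & S] ->
  marked_decomp (al * seven_cycle x p1 p2 p3 p4 p5 p6)
    [:: p1, p2, p3, p4, p5, p6 & S] x (a + 6) sa.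
Proof.
move=> dal uS; have pS : perm_eq [:: p6, p5, p4, p3, p2, p1 & S] [:: p1, p2, p3, p4, p5, p6 & S].
  by perm_count.
rewrite -(perm_uniq pS) in uS; apply: marked_decomp_perm pS _.
move: uS; rewrite cons_uniq => /andP[n6]; rewrite cons_uniq => /andP[n5].
rewrite cons_uniq => /andP[n4]; rewrite cons_uniq => /andP[n3].
rewrite cons_uniq => /andP[n2]; rewrite cons_uniq => /andP[n1 _].
by rewrite /seven_cycle !mulgA !addnS addn0; do 6!apply: marked_decomp_growr => //.
Qed.

Lemma take_out_six (S0 : seq T) : 6 <= size S0 -> exists p1 p2 p3 p4 p5 p6 S,
  S0 = [:: p1, p2, p3, p4, p5, p6 & S].
Proof.
by move: S0 => [|p1 [|p2 [|p3 [|p4 [|p5 [|p6 S]]]]]] // _; exists p1, p2, p3, p4, p5, p6, S.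
Qed.

(* three conjugates with prescribed parities of conjugators *)
(** The conjugators h1, h2, h3 that come with the insertion of the 7-cycle have
    uncontrolled parities; those of g1, g2, g3 are chosen to compensate them. *)
Lemma triple_even_conj (a b c si ta ze : {perm T}) S x p1 p2 p3 p4 p5 p6
    a0 sa b0 sb c0 sc L1 L2 L3 (h : {perm T}) :
    marked_decomp a S x a0 sa -> marked_decomp b S x b0 sb -> marked_decomp c S x c0 sc ->
    perm_eq [:: p1, p2, p3, p4, p5, p6 & S] (enum T) ->
    full_decomp si L1 -> perm_eq (shape L1) (a0 + 6 :: sa)%N ->
    full_decomp ta L2 -> perm_eq (shape L2) (b0 + 6 :: sb)%N ->
    full_decomp ze L3 -> perm_eq (shape L3) (c0 + 6 :: sc)%N ->
  exists g1 g2 g3 : {perm T}, [/\ ~~ odd_perm g1, ~~ odd_perm g2, ~~ odd_perm g3 &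
    si ^ g1 * ta ^ g2 * ze ^ g3 = (a * b * c) ^ h].
Proof.
move=> da db dc pT dsi psi dta pta dze pze.
have uS : uniq [:: p1, p2, p3, p4, p5, p6 & S] by rewrite (perm_uniq pT) enum_uniq.
have uxp : uniq [:: x; p1; p2; p3; p4; p5; p6].
  have xS := marked_decomp_mem da; have pS := perm_to_rem xS.
  have : perm_eq [:: p1, p2, p3, p4, p5, p6 & S] ([:: x; p1; p2; p3; p4; p5; p6] ++ rem x S).
    apply: (perm_trans (y := [:: p1; p2; p3; p4; p5; p6] ++ (x :: rem x S))).
      by rewrite (perm_cat2l [:: p1; p2; p3; p4; p5; p6]).
    exact: permEl (perm_catCA [:: p1; p2; p3; p4; p5; p6] [:: x] (rem x S)).
  by move/perm_uniq; rewrite uS cat_uniq => /esym/and3P[].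
have fixp al a1 sa1 : marked_decomp al S x a1 sa1 ->
    {in [:: p1; p2; p3; p4; p5; p6], al =1 id}.
  move=> dal y yp; apply: (marked_decomp_fix dal).
  move: uS; rewrite (cat_uniq [:: p1; p2; p3; p4; p5; p6] S) => /and3P[_ /hasPn nS _].
  by apply: contraL yp => /nS.
have [h1 eq1] := marked_decomp_conj (seven_cycle_marked da uS) pT dsi psi.
have [h2 eq2] := marked_decomp_conj (seven_cycle_marked db uS) pT dta pta.
have [h3 eq3] := marked_decomp_conj (seven_cycle_marked dc uS) pT dze pze.
have [g1 [g2 [g3 [o1 o2 o3 eqg]]]] := prescribed_parities uxp
  (odd_perm h1 (+) odd_perm h) (odd_perm h2 (+) odd_perm h) (odd_perm h3 (+) odd_perm h)
  (fixp _ _ _ da) (fixp _ _ _ db) (fixp _ _ _ dc).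
exists (h1 * g1 * h), (h2 * g2 * h), (h3 * g3 * h).
split; rewrite ?odd_permM ?o1 ?o2 ?o3; try by do 2 case: odd_perm.
by rewrite !conjgM eq1 eq2 eq3 -!conjMg eqg.
Qed.

(** The product si ^ g * ta ^ h * ze^-1 = 1 is treated as a triple, so that the
    inserted 7-cycle also fixes the parity on the side of ze. *)
Lemma hub_type_even_conj si ta ze A C L L' :
    full_decomp si (A :: L) -> full_decomp ta (C :: L') ->
    7 < size A -> 8 < size C -> odd_perm si = odd_perm ta ->
    size L + size L' + 8 <= #|T| -> hub_type ze ->
  exists g h : {perm T}, [/\ ~~ odd_perm g, ~~ odd_perm h & si ^ g * ta ^ h = ze].
Proof.
move=> dsi dta sA sC par le_n [L3 dze pze].
have := full_decomp_odd dsi; have := full_decomp_odd dta; rewrite par => -> /= eqo.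
have := full_decomp_size dsi; have := full_decomp_size dta => /= sumC sumA.
have /= /andP[_ pA] := full_decomp_pos dsi; have /= /andP[_ pC] := full_decomp_pos dta.
have l6 : 6 <= size (enum T) by rewrite -cardT; lia.
have [p1 [p2 [p3 [p4 [p5 [p6 [S eqT]]]]]]] := take_out_six l6.
have sS : (size A + sumn (shape L) = size S + 6)%N by rewrite sumA cardE eqT /=; lia.
have uS : uniq S by have := enum_uniq T; rewrite eqT => /= /and5P[_ _ _ _ /and3P[]].
have evn : ~~ odd (size (shape L) + size (shape L')).
  by rewrite !size_map oddD; move: eqo; do 3 case: odd.
have n1 : size S = (size A - 6 + sumn (shape L))%N by lia.
have n2 : (size A - 6 + sumn (shape L) = size C - 6 + sumn (shape L'))%N by lia.
have n3 : size (shape L) + size (shape L') + 2 <= size S.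
  by move: le_n; rewrite !size_map -sumA; lia.
have sA6 : 1 < size A - 6 by lia.
have sC6 : 2 < size C - 6 by lia.
have [al [ga [x [dal dga dz]]]] := hub_any_parity uS n1 n2 sA6 sC6 pA pC evn n3.
have odd6 : odd #|T| = odd (size S) by rewrite -sumA sS oddD addbF.
have dzeV := full_decompV dze.
have pzV : perm_eq (shape (map rev L3)) (hub_base (size S) + 6 :: hub_rest (size S))%N.
  rewrite shape_map_rev; apply: perm_trans pze _.
  have S_gt0 : 0 < size S by case: (S) (marked_decomp_mem dal).
  rewrite /hub_base /hub_rest odd6 -sumA sS; case: odd; first exact: perm_refl.
  suff -> : ((size S + 6).-1 = (size S).-1 + 6)%N by apply: perm_refl.
  lia.
have pT : perm_eq [:: p1, p2, p3, p4, p5, p6 & S] (enum T) by rewrite eqT.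
have pA6 : perm_eq (shape (A :: L)) (size A - 6 + 6 :: shape L)%N.
  by rewrite (subnK (ltnW (ltnW sA))).
have pC6 : perm_eq (shape (C :: L')) (size C - 6 + 6 :: shape L')%N.
  by rewrite (subnK (ltnW (ltnW (ltnW sC)))).
have [g1 [g2 [g3 [o1 o2 o3 eqg]]]] :=
  triple_even_conj 1 dal dga (marked_decompV dz) pT dsi pA6 dta pC6 dzeV pzV.
exists (g1 * g3^-1), (g2 * g3^-1); rewrite !odd_permM odd_permV (negPf o1) (negPf o2) (negPf o3).
split=> //; rewrite !conjgM -conjMg.
move: eqg; rewrite mulgV conj1g conjVg => /(canRL (mulgK _)).
by rewrite mul1g invgK => ->; rewrite conjgK.
Qed.

End Products.

(** * Odd blocks: products of three full cycles *)

Section Near.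
Local Open Scope group_scope.
Variable T : finType.
Implicit Types (a b c e al be ga z ta : {perm T}) (A B C S X Y Z R : seq T) (L : seq (seq T)).

Definition cycle_on al B := exists2 Z, cycle_decomp al [:: Z] & perm_eq Z B.

Lemma cycle_on_marked al B x : cycle_on al B -> x \in B ->
  marked_decomp al B x (size B) [::].
Proof.
move=> [Z dZ pZ] Bx; exists Z, [::].
by split; rewrite ?(perm_size pZ) ?(perm_mem pZ) //= cats0.
Qed.

Lemma marked_cycle_on al B x l : marked_decomp al B x l [::] -> cycle_on al B.
Proof.
case=> A [L [dL pS _ /perm_nilP sL _]]; exists A.
  by case: L sL dL {pS} => //.
by case: L sL pS {dL} => //= _; rewrite cats0.
Qed.

Lemma cycle_on_decomp al B : cycle_on al B -> exists L,
  [/\ cycle_decomp al L, perm_eq (flatten L) B & shape L = [:: size B]].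
Proof.
by case=> Z dZ pZ; exists [:: Z]; rewrite /= cats0 (perm_size pZ).
Qed.

Lemma cycle_onV al B : cycle_on al B -> cycle_on al^-1 B.
Proof.
by case=> Z dZ pZ; exists (rev Z); [exact: (cycle_decompV dZ) | rewrite perm_rev].
Qed.

Lemma cycle_onJ al B (g : {perm T}) : (forall x, x \notin B -> g x = x) ->
  cycle_on al B -> cycle_on (al ^ g) B.
Proof.
move=> gB [Z dZ pZ]; exists (map g Z); first exact: (cycle_decompJ g dZ).
have uZ : uniq Z by case: dZ; rewrite /= cats0.
apply: uniq_perm; rewrite ?(map_inj_uniq perm_inj) -?(perm_uniq pZ) //.
move=> x; rewrite -(permKV g x) (mem_map perm_inj) (perm_mem pZ).
move: (g^-1 x) => {}x; have [Bx|nBx] := boolP (x \in B); last by rewrite gB // (negPf nBx).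
apply/esym/negPn/negP => nB; have := gB _ nB => /perm_inj eqx.
by rewrite eqx Bx in nB.
Qed.

Lemma cycle_on_conj al be B : cycle_on al B -> cycle_on be B ->
  exists2 g : {perm T}, al ^ g = be & forall x, x \notin B -> g x = x.
Proof.
move=> [Z dZ pZ] [Z' dZ' pZ'].
have [||g alg gfix] := cycle_decomp_conj_shape dZ dZ'.
- by rewrite /= !cats0 (perm_trans pZ) // perm_sym.
- by rewrite /= (perm_size pZ) (perm_size pZ').
by exists g => // x; rewrite -(perm_mem pZ) => nx; apply: gfix; rewrite /= cats0.
Qed.

(** Two applications of the hub: a full cycle times ta is a full cycle z, and z is a
    product of two full cycles. *)
Lemma product_of_three_cycles ta B L : uniq B -> odd (size B) -> cycle_decomp ta L ->
    perm_eq (flatten L) B -> [::] \notin L -> odd (size L) ->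
  exists a b c, [/\ cycle_on a B, cycle_on b B, cycle_on c B & a * b * c = ta].
Proof.
move=> uB oB dta pL; case: L dta pL => // C L dta pL nL oL.
have eqB : (size B + 0 = size C + sumn (shape L))%N.
  by rewrite addn0 -(perm_size pL) size_flatten.
have pos D : D \in C :: L -> 0 < size D by case: D => // LD; rewrite LD in nL.
have pC : 0 < size C by rewrite pos ?mem_head.
have pS : all (leq 1) (shape L).
  by apply/allP => _ /mapP[D LD ->]; apply: pos; rewrite in_cons LD orbT.
have leS := sumn_ge pS; rewrite size_map mul1n in leS.
rewrite /= in oL; have B_gt0 : 0 < size B by case: (size B) oB.
have hg : ((size (@nil nat) + size (shape L)).+1 + ((size B - (size L).+1)./2).*2 = size B + 0)%N.
  by rewrite size_map /= addn0; lia.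
have hac : (size B + 0 == 1)%N || (2 < size B + size C) by lia.
have [al [ga [x [Z [dal dga dz pZ]]]]] :=
  @hub_exists T _ _ [::] _ _ eqB B_gt0 pC isT pS hg hac B uB (esym (addn0 _)).
have hg' : ((size (@nil nat) + size (@nil nat)).+1 + ((size B).-1./2).*2 = size B + 0)%N.
  by rewrite /= addn0; lia.
have hac' : (size B + 0 == 1)%N || (2 < size B + size B) by lia.
have [al' [ga' [x' [Z' [dal' dga' dz' pZ']]]]] :=
  @hub_exists T _ _ [::] _ [::] erefl B_gt0 B_gt0 isT isT hg' hac' B uB (esym (addn0 _)).
have [A [L' [dA pA sA psA _]]] := dga.
have [||g gag gfix] := cycle_decomp_conj_shape dA dta.
- by rewrite (perm_trans pA) // perm_sym.
- by rewrite /= sA perm_cons.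
have {}gfix y : y \notin B -> g y = y by rewrite -(perm_mem pA); apply: gfix.
have cz : cycle_on (al * ga) B by exists Z.
have cz' : cycle_on (al' * ga') B by exists Z'.
have cal := marked_cycle_on dal.
have [h eqh hfix] := cycle_on_conj cz' (cycle_onJ gfix cz).
exists (al^-1 ^ g), (al' ^ h), (ga' ^ h); split.
- exact: cycle_onJ (cycle_onV cal).
- exact: cycle_onJ (marked_cycle_on dal').
- exact: cycle_onJ (marked_cycle_on dga').
- by rewrite -mulgA -conjMg eqh -conjMg mulKg.
Qed.

End Near.

(** * Two cycles of even length *)

Section Pairs.
Local Open Scope group_scope.
Variable T : finType.
Implicit Types (a b c e al be ga ta : {perm T}) (x y z p q : T)
  (A B C S X Y Z R : seq T) (L : seq (seq T)).

(** A path may be followed by another map after renaming its points. *)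
Lemma fpath_relabel (f f' phi : T -> T) s x y l :
    f' y = phi (f x) -> {in s, forall w, f' (phi w) = phi (f w)} ->
  fpath f x (rcons s l) -> fpath f' y (rcons (map phi s) (phi l)).
Proof.
elim: s x y => [|w s IH] x y f'y f's /=; first by rewrite !andbT f'y => /eqP ->.
case/andP=> /eqP fx cs; rewrite f'y fx eqxx /=; apply: IH cs.
  by rewrite f's ?mem_head.
by move=> v sv; apply: f's; rewrite in_cons sv orbT.
Qed.

Definition decomp_on al S s := exists L,
  [/\ cycle_decomp al L, perm_eq (flatten L) S & perm_eq (shape L) s].

(* two cycles, of lengths l and m, the first one containing X *)
Definition two_cycles al X S l m := exists A1 A2,
  [/\ cycle_decomp al [:: A1; A2], perm_eq (A1 ++ A2) S, size A1 = l, size A2 = m &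
      {subset X <= A1}].

Lemma two_cycles_insertr e Z Y y z p q : cycle_decomp e [:: Z; Y] ->
    z \in Z -> y \in Y -> uniq [:: p, q & Z ++ Y] ->
  two_cycles (e * (tperm z p * tperm y q)) Z [:: p, q & Z ++ Y] (size Z).+1 (size Y).+1.
Proof.
move=> de Zz Yy; rewrite /= inE negb_or => /and3P[/andP[pq pZY] qZY _].
have [|A1 pA1 d1] := cycle_decomp_insertr (p := p) de Zz; first by rewrite /= cats0.
have {}d1 : cycle_decomp (e * tperm z p) [:: Y; A1].
  by apply: cycle_decomp_perm d1 _; rewrite (perm_catC [:: A1] [:: Y]).
have [|A2 pA2 d2] := cycle_decomp_insertr (p := q) d1 Yy.
  move: qZY; rewrite /= cats0 !mem_cat (perm_mem pA1) inE !negb_or eq_sym pq => /andP[-> ->] //.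
exists A1, A2; split; rewrite ?(perm_size pA1) ?(perm_size pA2) //.
- rewrite mulgA; apply: cycle_decomp_perm d2 _; exact: (permEl (perm_catC [:: A2] [:: A1])).
- by rewrite (perm_trans (perm_cat pA1 pA2)) //; perm_count.
- by move=> w Zw; rewrite (perm_mem pA1) inE Zw orbT.
Qed.

Lemma two_cycles_insertl e Z Y y z p q : cycle_decomp e [:: Z; Y] ->
    z \in Z -> y \in Y -> uniq [:: p, q & Z ++ Y] ->
  two_cycles ((tperm y p * tperm z q) * e) Z [:: p, q & Z ++ Y] (size Z).+1 (size Y).+1.
Proof.
move=> de Zz Yy; rewrite /= inE negb_or => /and3P[/andP[pq pZY] qZY _].
have [|A1 pA1 d1] := cycle_decomp_insertl (p := q) de Zz; first by rewrite /= cats0.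
have {}d1 : cycle_decomp (tperm z q * e) [:: Y; A1].
  by apply: cycle_decomp_perm d1 _; rewrite (perm_catC [:: A1] [:: Y]).
have [|A2 pA2 d2] := cycle_decomp_insertl (p := p) d1 Yy.
  move: pZY; rewrite /= cats0 !mem_cat (perm_mem pA1) inE !negb_or pq => /andP[-> ->] //.
exists A1, A2; split; rewrite ?(perm_size pA1) ?(perm_size pA2) //.
- rewrite -mulgA; apply: cycle_decomp_perm d2 _; exact: (permEl (perm_catC [:: A2] [:: A1])).
- by rewrite (perm_trans (perm_cat pA1 pA2)) //; perm_count.
- by move=> w Zw; rewrite (perm_mem pA1) inE Zw orbT.
Qed.

(** The crossed transpositions on the two sides of e send the new points p and q to
    exchanged roles: one cycle of the result is that of Z with z replaced by p and
    q, the other is that of Y with z added. *)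
Lemma two_cycles_middle e Z Y y z p q : cycle_decomp e [:: Z; Y] ->
    z \in Z -> y \in Y -> uniq [:: p, q & Z ++ Y] ->
  two_cycles ((tperm y q * tperm z p) * e * (tperm z q * tperm (e y) p))
    (rem z Z) [:: p, q & Z ++ Y] (size Z).+1 (size Y).+1.
Proof.
move=> de Zz Yy uS.
have [Z' pZ' d1] := cycle_decomp_rot_to de Zz.
have {}d1 : cycle_decomp e [:: Y; z :: Z'].
  by apply: cycle_decomp_perm d1 _; rewrite (perm_catC [:: _ :: _] [:: Y]).
have [Y0 pY0 d2] := cycle_decomp_rot_to d1 Yy.
have pS : perm_eq [:: p, q & Z ++ Y] [:: p, q & (z :: Z') ++ (y :: Y0)].
  by rewrite !perm_cons perm_cat.
move: (uS); rewrite (perm_uniq pS) 2!cons_uniq inE !mem_cat cat_uniq.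
case/and3P=> + + /and3P[_ /hasPn dis _]; move=> /norP[pq /norP[pZ pY]] /norP[qZ qY].
have [_ /and3P[cY cZ _] fe] := d2.
have fe' w : w \notin (y :: Y0) ++ (z :: Z') -> e w = w by move=> ?; apply: fe; rewrite /= cats0.
have fep : e p = p by apply: fe'; rewrite mem_cat negb_or pY pZ.
have feq : e q = q by apply: fe'; rewrite mem_cat negb_or qY qZ.
have eY w : w \in y :: Y0 -> e w \in y :: Y0 by rewrite (fcycle_mem _ cY).
have eZ w : w \in z :: Z' -> e w \in z :: Z' by rewrite (fcycle_mem _ cZ).
have neq (s1 s2 : seq T) v w : v \in s1 -> w \in s2 -> {in s1, forall u, u \notin s2} -> v != w.
  by move=> sv sw d; apply: contraTneq sw => <-; apply: d.
have YZ v w : v \in y :: Y0 -> w \in z :: Z' -> v != w.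
  by move=> Yv Zw; apply: neq Yv Zw dis.
have nY v : v \in y :: Y0 -> [/\ z != v, p != v & q != v].
  move=> Yv; split; first by rewrite eq_sym YZ ?mem_head.
    by apply: contraNneq pY => ->.
  by apply: contraNneq qY => ->.
have nZ v : v \in z :: Z' -> [/\ y != v, p != v & q != v].
  move=> Zv; split; first by rewrite YZ ?mem_head.
    by apply: contraNneq pZ => ->.
  by apply: contraNneq qZ => ->.
have [yY zZ] : y \in y :: Y0 /\ z \in z :: Z' by rewrite !mem_head.
have [zy py qy] := nY y yY; have [yz pz qz] := nZ z zZ.
have [zey pey qey] := nY _ (eY _ yY).
(* On the points of Z, phi replaces z by q. *)
pose phi := tperm z q.
have phiZ v : v \in z :: Z' -> tperm (e y) p (phi v) = phi v.
  move=> Zv; have [yv pv qv] := nZ v Zv.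
  rewrite /phi; case: (tpermP z q v) => [_|eqv|_ _].
  - by rewrite tpermD // eq_sym.
  - by rewrite eqv eqxx in qv.
  - by rewrite tpermD // YZ ?eY.
set e' := _ * e * _.
have e'E w : e' w = tperm (e y) p (phi (e (tperm z p (tperm y q w)))) by rewrite !permM.
have e'z : e' z = e y.
  rewrite e'E (tpermD yz qz) tpermL fep /phi (@tpermD _ z q p) // 1?eq_sym //.
  by rewrite tpermR.
have e'p : e' p = phi (e z).
  by rewrite e'E (@tpermD _ y q p) // 1?eq_sym // tpermR phiZ ?eZ.
have e'y : e' y = z.
  by rewrite e'E tpermL (@tpermD _ z p q) // 1?eq_sym // feq /phi tpermR tpermD // eq_sym.
have e'q : e' q = p.
  by rewrite e'E tpermR (tpermD zy py) /phi (tpermD zey qey) tpermL.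
have e'Z w : w \in z :: Z' -> w != z -> e' w = phi (e w).
  move=> Zw wz; have [yw pw qw] := nZ w Zw.
  by rewrite e'E (tpermD yw qw) (@tpermD _ z p w) // 1?eq_sym // phiZ ?eZ.
have e'Y w : w \in y :: Y0 -> w != y -> e' w = e w.
  move=> Yw wy; have [zw pw qw] := nY w Yw; have [zew pew qew] := nY _ (eY _ Yw).
  rewrite e'E (@tpermD _ y q w) // 1?eq_sym // (tpermD zw pw) /phi (tpermD zew qew).
  by rewrite tpermD // (inj_eq perm_inj) eq_sym.
have uZY : uniq (z :: Z') /\ uniq (y :: Y0).
  by move: uS; rewrite (perm_uniq pS) 2!cons_uniq cat_uniq => /and3P[_ _ /and3P[]].
case: uZY => /andP[zZ' uZ'] /andP[yY0 uY0].
have phiid w : w \in Z' -> phi w = w.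
  move=> Zw; have [|_ _ qw] := nZ w; first by rewrite in_cons Zw orbT.
  by rewrite /phi tpermD //; apply: contraNneq zZ' => ->.
have szZ := perm_size pZ'; have szY := perm_size pY0.
have pS' : perm_eq ((p :: rcons Z' q) ++ (z :: rcons Y0 y)) [:: p, q & Z ++ Y].
  by rewrite perm_sym (perm_trans pS) // -!cats1; perm_count.
exists (p :: rcons Z' q), (z :: rcons Y0 y); split.
- have fl : flatten [:: p :: rcons Z' q; z :: rcons Y0 y] =
    (p :: rcons Z' q) ++ (z :: rcons Y0 y) by rewrite /= cats0.
  split; first by rewrite fl (perm_uniq pS').
  + rewrite /= andbT; apply/andP; split; rewrite rcons_path last_rcons /= ?e'q ?e'y eqxx andbT.
      have -> : rcons Z' q = rcons (map phi Z') (phi z).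
        by rewrite /phi tpermL; congr rcons; rewrite -[LHS]map_id; apply/eq_in_map => w /phiid.
      apply: fpath_relabel cZ => // w Zw; rewrite phiid // e'Z ?in_cons ?Zw ?orbT //.
      by apply: contraNneq zZ' => <-.
    apply: fpath_restart cY => // w Yw; rewrite e'Y ?in_cons ?Yw ?orbT //.
    by apply: contraNneq yY0 => <-.
  + move=> w; rewrite fl (perm_mem pS') (perm_mem pS) 2!in_cons mem_cat.
    case/norP=> wp /norP[wq /norP[wZ wY]]; rewrite e'E.
    have [wz wy] : w != z /\ w != y.
      by split; [move: wZ | move: wY]; rewrite inE negb_or => /andP[].
    have ew : e w = w by apply: fe'; rewrite mem_cat; apply/norP.
    have wey : w != e y by apply: contraNneq wY => ->; apply: eY.
    rewrite eq_sym in wz; rewrite eq_sym in wy; rewrite eq_sym in wp.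
    rewrite eq_sym in wq; rewrite eq_sym in wey.
    by rewrite (tpermD wy wq) (tpermD wz wp) ew /phi (tpermD wz wq) tpermD.
- exact: pS'.
- by rewrite /= size_rcons szZ.
- by rewrite /= size_rcons szY.
- move=> w; have uZ : uniq Z by rewrite (perm_uniq pZ') /= zZ'.
  rewrite (mem_rem_uniq z uZ) inE (perm_mem pZ') !inE => /andP[/negPf-> /= Zw].
  by rewrite mem_rcons in_cons Zw !orbT.
Qed.

End Pairs.

(** * Triples of permutations of one cycle type *)

Section Triples.
Local Open Scope group_scope.
Variable T : finType.
Implicit Types (a b c e al be ga ta : {perm T}) (x y z p q : T)
  (A B C S X Y Z R : seq T) (L : seq (seq T)).

Lemma fix_outside_commute a b S B : {in S, forall x, x \notin B} ->
    (forall x, x \notin S -> a x = x) -> (forall x, x \notin B -> b x = x) ->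
  commute a b.
Proof.
move=> dis fa fb; have dis' : [disjoint [set x in S] & [set x in B]].
  by rewrite disjoint_subset; apply/subsetP => x; rewrite !inE => /dis.
apply: (@perm_onC _ [set x in S] [set x in B]) => //.
  by apply/subsetP => x; rewrite !inE; apply: contraR => /fa/eqP.
by apply/subsetP => x; rewrite !inE; apply: contraR => /fb/eqP.
Qed.

Lemma cycle_decomp_cat a b L L' : uniq (flatten L ++ flatten L') ->
  cycle_decomp a L -> cycle_decomp b L' -> cycle_decomp (a * b) (L ++ L').
Proof.
move=> uLL [uL cL fL] [uL' cL' fL'].
move: (uLL); rewrite cat_uniq => /and3P[_ /hasPn dis _].
have in_flat (K : seq (seq T)) C x : C \in K -> x \in C -> x \in flatten K.
  by move=> KC Cx; apply/flattenP; exists C.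
have flatL x : x \in flatten L -> (a * b) x = a x.
  move=> Lx; rewrite permM fL' //; apply: contraL Lx => /dis.
  apply: contra; case/flattenP => C LC Cx.
  by apply: (in_flat _ C) => //; rewrite (fcycle_mem _ (allP cL _ LC)).
have flatL' x : x \in flatten L' -> (a * b) x = b x.
  by move=> Lx; rewrite permM fL //; apply: dis.
split; first by rewrite flatten_cat.
  rewrite all_cat; apply/andP; split; apply/allP => C LC.
    by rewrite (@eq_in_fcycle _ _ a) ?(allP cL) // => x Cx; apply: flatL; apply: in_flat Cx.
  by rewrite (@eq_in_fcycle _ _ b) ?(allP cL') // => x Cx; apply: flatL'; apply: in_flat Cx.
move=> x; rewrite flatten_cat mem_cat => /norP[xL xL'].
by rewrite permM fL // fL'.
Qed.

Lemma decomp_on_fix a S s : decomp_on a S s -> forall x, x \notin S -> a x = x.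
Proof. by case=> L [[_ _ fL] pL _] x; rewrite -(perm_mem pL); apply: fL. Qed.

Lemma cycle_on_decomp_on a B : cycle_on a B -> decomp_on a B [:: size B].
Proof. by case/cycle_on_decomp => L [dL pL sL]; exists L; rewrite sL. Qed.

Lemma two_cycles_decomp_on a X S l m : two_cycles a X S l m -> decomp_on a S [:: l; m].
Proof.
by case=> A1 [A2 [dA pA <- <- _]]; exists [:: A1; A2]; rewrite /= cats0.
Qed.

Lemma two_cycles_marked a X S l m x : two_cycles a X S l m -> x \in X ->
  marked_decomp a S x l [:: m].
Proof.
case=> A1 [A2 [dA pA sA1 <- sub]] Xx; exists A1, [:: A2].
by rewrite /= cats0; split=> //; apply: sub.
Qed.

Lemma marked_decomp_cat a S x l s b B t : marked_decomp a S x l s ->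
  decomp_on b B t -> uniq (S ++ B) -> marked_decomp (a * b) (S ++ B) x l (s ++ t).
Proof.
case=> A [L [dL pS sA ps Ax]] [L' [dL' pB pt]] uSB; exists A, (L ++ L').
have pSB : perm_eq (flatten ((A :: L) ++ L')) (S ++ B) by rewrite flatten_cat perm_cat.
split=> //; last by rewrite /shape map_cat perm_cat.
by apply: (@cycle_decomp_cat _ _ (A :: L)) => //; rewrite -flatten_cat (perm_uniq pSB).
Qed.

Definition marked_triple ta S x l s := exists a b c,
  [/\ marked_decomp a S x l s, marked_decomp b S x l s, marked_decomp c S x l s &
      a * b * c = ta].

(** Such triples fill up the cycle type of a triple without changing its
    product. *)
Definition unit_triple B t := exists a b c,
  [/\ decomp_on a B t, decomp_on b B t, decomp_on c B t & a * b * c = 1].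

Lemma mul_commute3 a b c a' b' c' : commute a' b -> commute a' c -> commute b' c ->
  a * a' * (b * b') * (c * c') = a * b * c * (a' * b' * c').
Proof.
move=> ab ac bc; rewrite -!mulgA; congr (a * _).
rewrite (mulgA a' b) ab -!mulgA; congr (b * _).
by rewrite (mulgA b' c) bc (mulgA a') (mulgA a' c) ac !mulgA.
Qed.

Lemma marked_triple_cat ta S x l s B t : marked_triple ta S x l s ->
  unit_triple B t -> uniq (S ++ B) -> marked_triple ta (S ++ B) x l (s ++ t).
Proof.
move=> [a [b [c [da db dc abc]]]] [a' [b' [c' [da' db' dc' abc']]]] uSB.
have dis : {in B, forall y, y \notin S}.
  by move: uSB; rewrite cat_uniq => /and3P[_ /hasPn].
have com (u v : {perm T}) : (forall y, y \notin B -> u y = y) ->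
    (forall y, y \notin S -> v y = y) -> commute u v by apply: fix_outside_commute.
exists (a * a'), (b * b'), (c * c'); split; try exact: marked_decomp_cat.
rewrite mul_commute3 ?abc ?abc' ?mulg1 //; apply: com;
  by [apply: decomp_on_fix; eassumption | move=> y; apply: marked_decomp_fix; eassumption].
Qed.

(** Products of three cycles on two odd blocks Z and Y give products of three
    permutations with two even cycles.  Let d, e, f be the products a a', b b', c c',
    let y' be the image of y under e, u = (z p)(y q) and v = (z q)(y' p).  Then d u,
    u^-1 e v and v^-1 f have the same product as d, e, f, and each has the two
    longer cycles. *)
Lemma pair_triple ta Z Y z p q a b c a' b' c' :
    uniq [:: p, q & Z ++ Y] -> z \in Z -> 0 < size Y ->
    cycle_on a Z -> cycle_on b Z -> cycle_on c Z -> a * b * c = ta ->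
    cycle_on a' Y -> cycle_on b' Y -> cycle_on c' Y -> a' * b' * c' = 1 ->
  exists u v w, [/\ two_cycles u (rem z Z) [:: p, q & Z ++ Y] (size Z).+1 (size Y).+1,
    two_cycles v (rem z Z) [:: p, q & Z ++ Y] (size Z).+1 (size Y).+1,
    two_cycles w (rem z Z) [:: p, q & Z ++ Y] (size Z).+1 (size Y).+1 & u * v * w = ta].
Proof.
move=> uS Zz; case defY: Y => [|y Y'] //; rewrite -defY => _.
have Yy : y \in Y by rewrite defY mem_head.
move=> [A dA pA] [B dB pB] [C dC pC] abc [A' dA' pA'] [B' dB' pB'] [C' dC' pC'] abc'.
have uZY : uniq (Z ++ Y) by move: uS => /= /and3P[].
have dis : {in Y, forall w, w \notin Z}.
  by move: uZY; rewrite cat_uniq => /and3P[_ /hasPn].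
have fixo d D W : cycle_decomp d [:: D] -> perm_eq D W -> forall w, w \notin W -> d w = w.
  by move=> [_ _ fD] pD w; rewrite -(perm_mem pD) => nw; apply: fD; rewrite /= cats0.
have com (u v : {perm T}) D W : cycle_decomp u [:: D] -> perm_eq D Y ->
    cycle_decomp v [:: W] -> perm_eq W Z -> commute u v.
  by move=> dD pD dW pW; apply: (fix_outside_commute dis); [apply: fixo dD pD | apply: fixo dW pW].
have dcat u D D' v : cycle_decomp u [:: D] -> perm_eq D Z -> cycle_decomp v [:: D'] ->
    perm_eq D' Y -> cycle_decomp (u * v) [:: D; D'].
  move=> dD pD dD' pD'; apply: (@cycle_decomp_cat _ _ [:: D]) => //.
  by rewrite /= !cats0 (perm_uniq (perm_cat pD pD')).
have norm u D D' : perm_eq D Z -> perm_eq D' Y ->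
    two_cycles u (rem z D) [:: p, q & D ++ D'] (size D).+1 (size D').+1 ->
    two_cycles u (rem z Z) [:: p, q & Z ++ Y] (size Z).+1 (size Y).+1.
  move=> pD pD' [E1 [E2 [dE pE sE1 sE2 sub]]]; exists E1, E2.
  rewrite -(perm_size pD) -(perm_size pD'); split=> //.
    by apply: perm_trans pE _; rewrite !perm_cons perm_cat.
  have uZ : uniq Z by move: uZY; rewrite cat_uniq => /andP[].
  move=> w wZ; apply: sub; move: wZ.
  by rewrite !mem_rem_uniq ?(perm_uniq pD) // !inE (perm_mem pD).
have uS' D D' : perm_eq D Z -> perm_eq D' Y -> uniq [:: p, q & D ++ D'].
  by move=> pD pD'; rewrite (perm_uniq (_ : perm_eq _ [:: p, q & Z ++ Y])) // !perm_cons perm_cat.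
have sub2 u D D' X : {subset rem z D <= X} ->
    two_cycles u X [:: p, q & D ++ D'] (size D).+1 (size D').+1 ->
    two_cycles u (rem z D) [:: p, q & D ++ D'] (size D).+1 (size D').+1.
  by move=> sX [E1 [E2 [dE pE sE1 sE2 sub]]]; exists E1, E2; split=> // w /sX /sub.
pose e := b * b'.
exists (a * a' * (tperm z p * tperm y q)),
  ((tperm y q * tperm z p) * e * (tperm z q * tperm (e y) p)),
  ((tperm (e y) p * tperm z q) * (c * c')); split.
- apply: (norm _ A A') => //; apply: (sub2 _ _ _ A); first exact: mem_rem.
  by apply: two_cycles_insertr; rewrite ?(perm_mem pA) ?(perm_mem pA') ?uS' //; apply: dcat.
- apply: (norm _ B B') => //; have de : cycle_decomp e [:: B; B'] by apply: dcat.
  by apply: two_cycles_middle; rewrite ?(perm_mem pB) ?(perm_mem pB') ?uS'.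
- apply: (norm _ C C') => //; apply: (sub2 _ _ _ C); first exact: mem_rem.
  have ey : e y \in C'.
    have [_ /and3P[_ cB' _] _] := dcat _ _ _ _ dB pB dB' pB'.
    by rewrite (perm_mem pC') -(perm_mem pB') (fcycle_mem _ cB') (perm_mem pB').
  by apply: two_cycles_insertl; rewrite ?(perm_mem pC) ?ey ?uS' //; apply: dcat.
- rewrite -abc -[RHS]mulg1 -abc' -(@mul_commute3 a b c a' b' c');
    first last;
    [by apply: com dB' pB' dC pC | by apply: com dA' pA' dC pC
    | by apply: com dA' pA' dB pB |].
  rewrite -/e; set u := tperm z p * tperm y q; set v := tperm z q * tperm (e y) p.
  have -> : tperm y q * tperm z p = u^-1 by rewrite invMg !tpermV.
  have -> : tperm (e y) p * tperm z q = v^-1 by rewrite invMg !tpermV.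
  by clearbody u v; rewrite /e !mulgA !mulgK.
Qed.

End Triples.

(** * Triples with product 1 *)

Section NearCube.
Local Open Scope group_scope.
Variable T : finType.
Implicit Types (a b c al be ga ta si : {perm T}) (x y z p q : T)
  (A B C S X Y Z R : seq T) (L : seq (seq T)).

Lemma cycle_decomp_nil : cycle_decomp (1 : {perm T}) [::].
Proof. by split=> // x _; rewrite perm1. Qed.

Lemma three_cycles_mul1 B : uniq B -> odd (size B) ->
  exists a b c, [/\ cycle_on a B, cycle_on b B, cycle_on c B & a * b * c = 1].
Proof.
move=> uB oB; apply: (@product_of_three_cycles _ 1 B [seq [:: x] | x <- B]) => //.
- split; rewrite ?flatten_seq1 //; last by move=> x _; rewrite perm1.
  by rewrite all_map; apply/allP => x _ /=; rewrite perm1 eqxx.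
- by rewrite flatten_seq1.
- by apply/negP => /mapP[].
- by rewrite size_map.
Qed.

Definition evens (s : seq nat) := count (fun d => ~~ odd d) s.

Lemma unit_triple_odd B : uniq B -> odd (size B) -> unit_triple B [:: size B].
Proof.
move=> uB oB; have [a [b [c [ca cb cc abc]]]] := three_cycles_mul1 uB oB.
by exists a, b, c; split; try exact: cycle_on_decomp_on.
Qed.

Lemma unit_triple_pair B d e : uniq B -> size B = (d + e)%N -> ~~ odd d -> ~~ odd e ->
  0 < d -> 0 < e -> unit_triple B [:: d; e].
Proof.
move=> uB sB; case: d sB => [|[|d]] // sB; case: e sB => [|[|e]] // sB /=.
rewrite !negbK => od oe _ _.
case: B sB uB => [|p [|q R]] // [sR] uB.
have sZ : size (take d.+1 R) = d.+1 by rewrite size_takel // sR; lia.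
have sY : size (drop d.+1 R) = e.+1 by rewrite size_drop sR; lia.
have oZ : odd (size (take d.+1 R)) by rewrite sZ.
have oY : odd (size (drop d.+1 R)) by rewrite sY.
have uR : uniq R by move: uB => /= /and3P[].
have [a [b [c [ca cb cc abc]]]] := three_cycles_mul1 (take_uniq d.+1 uR) oZ.
have [a' [b' [c' [ca' cb' cc' abc']]]] := three_cycles_mul1 (drop_uniq d.+1 uR) oY.
have [z Zz] : exists z, z \in take d.+1 R.
  by case: (take d.+1 R) sZ => // z ? _; exists z; rewrite mem_head.
have uB' : uniq [:: p, q & take d.+1 R ++ drop d.+1 R] by rewrite cat_take_drop.
have [|u [v [w [du dv dw uvw]]]] := pair_triple uB' Zz _ ca cb cc abc ca' cb' cc' abc'.
  by rewrite sY.
move: du dv dw; rewrite cat_take_drop sZ sY => du dv dw.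
by exists u, v, w; split; try apply: two_cycles_decomp_on; eassumption.
Qed.

Lemma decomp_on_shape a B (s t : seq nat) : perm_eq s t -> decomp_on a B s -> decomp_on a B t.
Proof. by move=> pst [L [dL pB ps]]; exists L; split=> //; apply: perm_trans pst. Qed.

Lemma decomp_on_cat a b B B' t t' : decomp_on a B t -> decomp_on b B' t' ->
  uniq (B ++ B') -> decomp_on (a * b) (B ++ B') (t ++ t').
Proof.
move=> [L [dL pB pt]] [L' [dL' pB' pt']] uBB; exists (L ++ L').
have pBB : perm_eq (flatten L ++ flatten L') (B ++ B') by rewrite perm_cat.
split; rewrite ?flatten_cat //; last by rewrite /shape map_cat perm_cat.
by apply: cycle_decomp_cat => //; rewrite (perm_uniq pBB).
Qed.

Lemma unit_triple_cat B B' t t' : unit_triple B t -> unit_triple B' t' ->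
  uniq (B ++ B') -> unit_triple (B ++ B') (t ++ t').
Proof.
move=> [a [b [c [da db dc abc]]]] [a' [b' [c' [da' db' dc' abc']]]] uBB.
have dis : {in B', forall y, y \notin B}.
  by move: uBB; rewrite cat_uniq => /and3P[_ /hasPn].
exists (a * a'), (b * b'), (c * c'); split; try exact: decomp_on_cat.
rewrite mul_commute3 ?abc ?abc' ?mulg1 //; apply: (fix_outside_commute dis);
  by apply: decomp_on_fix; eassumption.
Qed.

Lemma unit_triple_shape B (s t : seq nat) : perm_eq s t -> unit_triple B s -> unit_triple B t.
Proof.
by move=> pst [a [b [c [da db dc abc]]]]; exists a, b, c; split=> //; apply: decomp_on_shape pst _.
Qed.

(** Odd lengths are treated one at a time and even lengths in pairs; the parity
    condition says that the permutations are even. *)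
Lemma unit_triple_exists s B : uniq B -> size B = sumn s -> all (leq 1) s ->
  ~~ odd (evens s) -> unit_triple B s.
Proof.
have [n] := ubnP (size s); elim: n s B => // n IH s B sn uB sB pos evn.
have split_step (t s' : seq nat) : perm_eq s (t ++ s') -> 0 < size t -> ~~ odd (evens t) ->
    unit_triple (take (sumn t) B) t -> unit_triple B s.
  move=> ps t_gt0 evt ut; apply: (unit_triple_shape (s := t ++ s')); first by rewrite perm_sym.
  have sB' : size B = (sumn t + sumn s')%N by rewrite sB (perm_sumn ps) sumn_cat.
  rewrite -(cat_take_drop (sumn t) B); apply: unit_triple_cat; rewrite ?cat_take_drop //.
  move: pos evn sn; rewrite (perm_all _ ps) (perm_size ps) /evens (seq.permP ps) all_cat size_cat.
  rewrite count_cat oddD (negPf evt) => /andP[_ pos] evn sn.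
  apply: IH; rewrite ?drop_uniq ?size_drop ?sB' // ?addKn //.
  by rewrite -ltnS; apply: leq_trans sn; rewrite ltnS -add1n leq_add2r.
have [/perm_has_cons[d od [s' ps]]|noodd] := boolP (has odd s).
  have led : d <= size B by rewrite sB (perm_sumn ps) /=; lia.
  apply: (split_step [:: d] s') => //=; first by rewrite /evens /= od.
  have -> : [:: d] = [:: size (take (d + 0) B)] by rewrite addn0 size_takel.
  by rewrite addn0; apply: unit_triple_odd; rewrite ?take_uniq // size_takel.
have allev : all (fun d => ~~ odd d) s by rewrite -all_predC in noodd.
case: s sn sB pos evn split_step {noodd} allev => [|d [|e s']] sn sB pos evn split_step allev.
- rewrite (size0nil sB); exists 1, 1, 1.
  by split; rewrite ?mulg1 //; exists [::]; split=> //; apply: cycle_decomp_nil.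
- by move: evn allev; rewrite /evens /= andbT addn0 => + ed; rewrite ed.
move: pos allev => /= /and3P[d0 e0 pos] /and3P[ed ee allev].
apply: (split_step [:: d; e] s') => //; first by rewrite /evens /= ed ee.
have le : d + (e + 0) <= size B by rewrite sB /=; lia.
apply: unit_triple_pair; rewrite ?take_uniq // size_takel //=; lia.
Qed.

(** If the number of even lengths in s is odd, the base cycle itself must have even
    length; it is then built together with one of the even cycles. *)
Lemma marked_triple_exists ta B L s R : uniq (B ++ R) -> odd (size B) -> 2 < size B ->
    cycle_decomp ta L -> perm_eq (flatten L) B -> [::] \notin L -> odd (size L) ->
    all (leq 1) s -> size R = (sumn s + odd (evens s))%N ->
  exists x, marked_triple ta (B ++ R) x (size B + odd (evens s)) s.
Proof.
move=> uBR oB B_gt2 dL pL nL oL pos sR.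
move: (uBR); rewrite cat_uniq => /and3P[uB dBR uR].
have [a [b [c [ca cb cc abc]]]] := product_of_three_cycles uB oB dL pL nL oL.
case defB: B B_gt2 => [|z [|x B']] // _; rewrite -defB.
have [zB xB] : z \in B /\ x \in B by rewrite defB !inE !eqxx orbT.
have xz : x \in rem z B.
  by rewrite mem_rem_uniq // inE xB andbT eq_sym; move: uB;
    rewrite defB /= inE negb_or => /andP[/andP[]].
exists x; have [odd_s|ev_s] := boolP (odd (evens s)); rewrite ?odd_s ?(negPf ev_s) in sR *.
  have : has (fun d => ~~ odd d) s by rewrite has_count; move: odd_s; rewrite /evens; case: count.
  case/perm_has_cons=> d ed [s' ps].
  have [d_gt0 pos'] : 0 < d /\ all (leq 1) s'.
    by move: pos; rewrite (perm_all _ ps) => /= /andP.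
  case: d ed ps d_gt0 => [|[|d]] // ed ps _.
  have evs' : ~~ odd (evens s').
    by move: odd_s; rewrite /evens (seq.permP ps) /= ed.
  rewrite (perm_sumn ps) /= in sR.
  have {}sR : size R = (d.+1 + sumn s').+2 by rewrite sR addn1.
  case: R sR uBR uR {dBR} => [|p [|q R]] // [sR] uBR uR.
  set Y := take d.+1 R; set R' := drop d.+1 R.
  have sY : size Y = d.+1 by rewrite size_takel // sR leq_addr.
  have oY : odd (size Y) by rewrite sY; move: ed => /=; rewrite negbK.
  have uR0 : uniq R by case/and3P: uR.
  have [a' [b' [c' [ca' cb' cc' abc']]]] := three_cycles_mul1 (take_uniq d.+1 uR0) oY.
  have pBR : perm_eq ([:: p, q & B ++ Y] ++ R') (B ++ [:: p, q & R]).
    by rewrite -(cat_take_drop d.+1 R) -/Y -/R'; perm_count.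
  have uS : uniq ([:: p, q & B ++ Y] ++ R') by rewrite (perm_uniq pBR).
  have uS1 : uniq [:: p, q & B ++ Y] by move: uS; rewrite cat_uniq => /andP[].
  have [|u [v [w [du dv dw uvw]]]] := pair_triple uS1 zB _ ca cb cc abc ca' cb' cc' abc'.
    by rewrite sY.
  have trip : marked_triple ta [:: p, q & B ++ Y] x (size B).+1 [:: (size Y).+1].
    by exists u, v, w; split=> //; apply: two_cycles_marked xz; eassumption.
  have ur : unit_triple R' s'.
    by apply: unit_triple_exists => //; rewrite ?drop_uniq // size_drop sR addKn.
  have [u' [v' [w' [du' dv' dw' uvw']]]] := marked_triple_cat trip ur uS.
  rewrite perm_sym in ps; rewrite sY -addn1 in du' dv' dw'.
  by exists u', v', w'; split=> //; apply: marked_decomp_perm pBR _;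
    apply: marked_decomp_shape ps _.
rewrite addn0; have trip : marked_triple ta B x (size B) [::].
  by exists a, b, c; split=> //; apply: cycle_on_marked.
have := marked_triple_cat trip (unit_triple_exists uR _ pos ev_s) uBR; apply.
by rewrite sR addn0.
Qed.

End NearCube.

(** * Permutations close to the identity *)

Section NearCube2.
Local Open Scope group_scope.
Variable T : finType.
Implicit Types (a b c al be ga ta si : {perm T}) (x y z p q : T)
  (A B C S X Y Z R : seq T) (L : seq (seq T)).

Lemma odd_evens (s : seq nat) : odd (evens s) = odd (sumn s) (+) odd (size s).
Proof.
elim: s => //= d s IH; rewrite /evens /= !oddD -/(evens s) IH oddb.
by do 3 case: odd.
Qed.

Definition long_cycles L := [seq C <- L | 1 < size C].
Definition short_cycles L := [seq C <- L | size C <= 1].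

Lemma perm_long_short L : perm_eq (long_cycles L ++ short_cycles L) L.
Proof.
have -> : short_cycles L = [seq C <- L | ~~ (1 < size C)].
  by apply: eq_filter => C; rewrite -leqNgt.
exact: (permEl (perm_filterC (fun C : seq T => 1 < size C) L)).
Qed.

Lemma size_short_cycles L : [::] \notin L ->
  size (flatten (short_cycles L)) = size (short_cycles L).
Proof.
elim: L => //= C L IH; rewrite in_cons negb_or => /andP[nC nL].
rewrite /short_cycles /=; case: ifP => //= C1; last exact: IH.
rewrite size_cat -/(short_cycles L) IH //.
by case: C nC C1 => [|y [|]].
Qed.

(** A cycle of length d > 1 has at most 2 (d - 1) points, so the support has at most
    twice as many points as there are missing cycles. *)
Lemma size_long_cycles L : [::] \notin L ->
  size (flatten (long_cycles L)) + (size L).*2 <= (size (flatten L)).*2.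
Proof.
elim: L => //= C L IH; rewrite in_cons negb_or size_cat => /andP[nC /IH{}IH].
rewrite /long_cycles /=; case: ifP => /= C1; rewrite -/(long_cycles L) ?size_cat.
  by move: C1 IH; clear; lia.
by have : 0 < size C; [by case: C nC {C1} | move: IH; clear; lia].
Qed.

(** The block B consists of the support of ta and of some of its fixed points, up to
    the length of the long cycle A minus 6 (room for the 7-cycle), and minus 1
    more if A has even length.  All other points are fixed by ta. *)
Lemma near_cube si ta A L K :
    full_decomp si (A :: L) -> full_decomp ta K -> ~~ odd_perm si -> ~~ odd_perm ta ->
    (#|T| - size K).*2 + 10 <= size A ->
  exists g1 g2 g3 : {perm T}, [/\ ~~ odd_perm g1, ~~ odd_perm g2, ~~ odd_perm g3 &
    si ^ g1 * si ^ g2 * si ^ g3 = ta].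
Proof.
move=> dsi dta esi eta le_m.
have /= sumA := full_decomp_size dsi.
have /= /andP[_ pos] := full_decomp_pos dsi.
have oddA : odd (evens (shape L)) = ~~ odd (size A).
  have := full_decomp_odd dsi; rewrite (negPf esi) -sumA odd_evens size_map oddD /=.
  by do 3 case: odd.
set eps := odd (evens (shape L)) in oddA *.
have [dK pK nK] := dta; have [uK cK fK] := dK.
pose m := (size A - (6 + eps))%N; pose LN := long_cycles K; pose F := flatten (short_cycles K).
have pNF : perm_eq (flatten LN ++ F) (enum T).
  by apply: perm_trans pK; rewrite -flatten_cat; apply: perm_flatten; apply: perm_long_short.
have uNF : uniq (flatten LN ++ F) by rewrite (perm_uniq pNF) enum_uniq.
have szNF : (size (flatten LN) + size F = #|T|)%N by rewrite -size_cat (perm_size pNF) -cardT.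
have szK : (size LN + size F = size K)%N.
  by rewrite /F size_short_cycles // -size_cat; apply: perm_size; apply: perm_long_short.
have szlong := size_long_cycles nK; rewrite (perm_size pK) -cardT -/LN in szlong.
have eps1 : eps <= 1 := leq_b1 _.
have lemA : (m + (6 + eps) = size A)%N.
  by apply: subnK; move: le_m eps1; clear; lia.
have le_long : size (flatten LN) <= m by move: szlong le_m lemA eps1; clear; lia.
have m_gt2 : 2 < m by move: le_m lemA eps1; clear; lia.
have om : odd m.
  have := congr1 odd lemA; rewrite !oddD oddb -[odd (size A)]negbK -oddA /=.
  by move: (eps : bool) (odd m) => [] [].
pose B := flatten LN ++ take (m - size (flatten LN)) F.
pose R0 := drop (m - size (flatten LN)) F.
have szA : (size (flatten LN) + size F = size A + sumn (shape L))%N by rewrite szNF sumA.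
have le_F : m - size (flatten LN) <= size F by move: szA lemA; clear; lia.
have sB : size B = m by rewrite size_cat size_takel // subnKC.
have pBR : perm_eq (B ++ R0) (enum T) by rewrite -catA cat_take_drop.
have sR0 : size R0 = (6 + (sumn (shape L) + eps))%N.
  by rewrite size_drop; move: szA lemA le_F le_long; clear; lia.
have l6 : 6 <= size R0 by rewrite sR0 leq_addr.
have [p1 [p2 [p3 [p4 [p5 [p6 [R eqR]]]]]]] := take_out_six l6.
have fixF x : x \in F -> ta x = x.
  case/flattenP => C; rewrite mem_filter => /andP[C1 KC] Cx.
  have /eqP -> := next_cycle (allP cK _ KC) Cx.
  case: C C1 {KC} Cx => [|y [|]] //= _; rewrite inE => /eqP ->.
  by rewrite eqxx.
pose K' := LN ++ [seq [:: x] | x <- take (m - size (flatten LN)) F].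
have flatK' : flatten K' = B by rewrite flatten_cat flatten_seq1.
have uBR : uniq (B ++ R0) by rewrite (perm_uniq pBR) enum_uniq.
have uB : uniq B by move: uBR; rewrite cat_uniq => /andP[].
have dK' : cycle_decomp ta K'.
  split; first by rewrite flatK'.
    rewrite all_cat; apply/andP; split; apply/allP => C.
      by rewrite mem_filter => /andP[_ KC]; apply: (allP cK).
    by case/mapP => x /mem_take Fx -> /=; rewrite fixF ?eqxx.
  move=> x; rewrite flatK' mem_cat negb_or => /andP[nx _]; apply: fixF.
  have : x \in flatten LN ++ F by rewrite (perm_mem pNF) mem_enum.
  by rewrite mem_cat (negPf nx).
have nK' : [::] \notin K'.
  rewrite mem_cat negb_or mem_filter /=; apply/negP => /mapP[x _] //.
have oK' : odd (size K').
  have := full_decomp_odd dta; rewrite (negPf eta) -szNF -szK !oddD => par.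
  rewrite size_cat size_map size_takel // oddD oddB // om.
  by move: par; do 3 case: odd.
have uBR' : uniq (B ++ R).
  apply: (subseq_uniq _ uBR); rewrite cat_subseq // eqR.
  exact: (suffix_subseq [:: p1; p2; p3; p4; p5; p6] R).
have sR : size R = (sumn (shape L) + eps)%N.
  by apply/eqP; rewrite -(eqn_add2l 6) -sR0 eqR.
have pfl : perm_eq (flatten K') B by rewrite flatK'.
rewrite -sB in om m_gt2.
have [x [a [b [c [da db dc abc]]]]] :=
  marked_triple_exists uBR' om m_gt2 dK' pfl nK' oK' pos sR.
have pT : perm_eq [:: p1, p2, p3, p4, p5, p6 & B ++ R] (enum T).
  by apply: perm_trans pBR; rewrite eqR; perm_count.
have pA : perm_eq (shape (A :: L)) (size B + eps + 6 :: shape L)%N.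
  by rewrite sB -addnA (addnC eps) lemA.
have := triple_even_conj 1 da db dc pT dsi pA dsi pA dsi pA.
by rewrite abc conjg1.
Qed.

End NearCube2.

(** * Permutations far from the identity *)

Section Far.
Local Open Scope group_scope.
Variable T : finType.
Implicit Types (a b c al be ga ta si ze : {perm T}) (x y z p q : T)
  (A B C S X Y Z R : seq T) (L K : seq (seq T)).

Lemma two_cycles_of_equal_size L : ~~ uniq (shape L) ->
  exists X Y K, perm_eq L [:: X, Y & K] /\ size X = size Y.
Proof.
elim: L => //= X L IH; rewrite negb_and negbK => /orP[/mapP[Y LY eqs]|/IH[Y [Z [K [pL eqs]]]]].
  by exists X, Y, (rem Y L); split=> //; rewrite perm_cons perm_to_rem.
exists Y, Z, (X :: K); split=> //; apply: (@perm_trans _ (X :: [:: Y, Z & K])).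
  by rewrite perm_cons.
exact: (permEl (perm_catCA [:: X] [:: Y; Z] K)).
Qed.

(** A permutation that maps a list to its rotation follows this list as a cycle. *)
Lemma map_shift_fpath (g : {perm T}) x s w :
  map g (x :: s) = rcons s w -> fpath g x (rcons s w).
Proof.
elim: s x => [|y s IH] x /= [gx].
  by rewrite gx eqxx.
by move=> ms; rewrite gx eqxx /=; apply: IH; rewrite /= ms.
Qed.

Lemma flatten_pairs X Y : size X = size Y ->
  perm_eq (flatten [seq [:: u.1; u.2] | u <- zip X Y]) (X ++ Y).
Proof.
elim: X Y => [|x X IH] [|y Y] //= [/IH{}IH]; rewrite perm_cons.
apply: (@perm_trans _ (y :: X ++ Y)); first by rewrite perm_cons.
by rewrite perm_sym; exact: (permEl (perm_catCA X [:: y] Y)).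
Qed.

Lemma map_id_fix (g : {perm T}) L x : map (map g) L = L -> x \in flatten L -> g x = x.
Proof.
move=> mL /flattenP[C LC Cx].
have : map (map g) L = map id L by rewrite map_id.
move/eq_in_map => /(_ C LC) /= mC.
have : map g C = map id C by rewrite map_id.
by move/eq_in_map => /(_ x Cx).
Qed.

(** Exchanging two cycles of the same odd length is an odd permutation that commutes
    with ta; for an even length, the cycle itself is one. *)
Lemma odd_centralizer ta L : full_decomp ta L -> ~~ uniq (shape L) ->
  exists2 h : {perm T}, odd_perm h & ta ^ h = ta.
Proof.
move=> [dL pL nL] /two_cycles_of_equal_size[X [Y [K [pLK sXY]]]].
have {}dL := cycle_decomp_perm dL pLK; have [uL cL fL] := dL.
have X_gt0 : 0 < size X.
  by rewrite lt0n; apply: contra nL => /nilP X0; rewrite (perm_mem pLK) X0 mem_head.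
have [oX|eX] := boolP (odd (size X)).
  (* h exchanges X and Y point by point; its cycles are the pairs in D. *)
  have pYX : perm_eq [:: X, Y & K] [:: Y, X & K] by exact: (permEl (perm_catCA [:: X] [:: Y] K)).
  have [||h [hta mh hfix]] := cycle_decomp_conj dL (cycle_decomp_perm dL pYX).
  - exact: perm_flatten.
  - by rewrite /= sXY.
  exists h => //; case: mh => mX mY mK.
  pose D := [seq [:: u.1; u.2] | u <- zip X Y].
  have pD := flatten_pairs sXY.
  have dD : cycle_decomp h D.
    split; first by rewrite (perm_uniq pD); move: uL; rewrite /= catA cat_uniq => /andP[].
      rewrite all_map; apply/allP => -[u v] uv /=; have lei : index (u, v) (zip X Y) < size X.
        by rewrite -(size1_zip (s := X) (t := Y)) ?sXY // index_mem.
      have := nth_index (u, v) uv; rewrite nth_zip // => -[nu nv].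
      have hu : h u = v by rewrite -{1}nu -(nth_map u v) // mX nv.
      have hv : h v = u by rewrite -{1}nv -(nth_map v u) -?sXY // mY nu.
      by rewrite hu hv !eqxx.
    move=> x; rewrite (perm_mem pD) mem_cat negb_or => /andP[xX xY].
    have [xK|nxK] := boolP (x \in flatten K); first exact: map_id_fix mK xK.
    by apply: hfix; rewrite /= !mem_cat !negb_or xX xY.
  rewrite (odd_perm_decomp dD); last by apply/negP => /mapP[].
  by rewrite (perm_size pD) size_cat size_map size1_zip sXY // oddD addbb -sXY.
have [||h [hta mh hfix]] := cycle_decomp_conj dL (cycle_decomp_rot 1 dL).
- by apply: perm_cat => //; rewrite perm_sym perm_rot.
- by rewrite /= size_rot.
exists h => //; case: mh => mX mY mK.
have dX : cycle_decomp h [:: X].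
  split; rewrite /= ?cats0; first by move: uL; rewrite /= cat_uniq => /andP[].
    rewrite andbT; case: (X) mX => // x s; rewrite rot1_cons => mX.
    exact: map_shift_fpath.
  move=> x xX; have [xK|nxK] := boolP (x \in flatten (Y :: K)).
    by apply: (map_id_fix (L := Y :: K)) => //=; rewrite mY mK.
  by apply: hfix; rewrite /= mem_cat negb_or xX.
rewrite (odd_perm_decomp dX) /= ?cats0 ?(negPf eX) //.
by rewrite inE eq_sym -size_eq0 -lt0n.
Qed.

Lemma full_decompJ al g L : full_decomp al L -> full_decomp (al ^ g) (map (map g) L).
Proof.
move=> [dL pL nL]; have dg := cycle_decompJ g dL; split=> //.
  rewrite -map_flatten; apply: uniq_perm; rewrite ?enum_uniq //.
    by rewrite (map_inj_uniq perm_inj); case: dL.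
  move=> x; rewrite mem_enum -(permKV g x) (mem_map perm_inj) (perm_mem pL).
  by rewrite mem_enum.
by apply: contra nL => /mapP[[|y C] LC] // _.
Qed.

Lemma hub_typeJ ze g : hub_type ze -> hub_type (ze ^ g).
Proof.
case=> L dL pL; exists (map (map g) L); first exact: full_decompJ.
suff -> : shape (map (map g) L) = shape L by [].
by rewrite /shape -map_comp; apply: eq_map => C /=; rewrite size_map.
Qed.

Lemma full_decomp_perm al L L' : perm_eq L L' -> full_decomp al L -> full_decomp al L'.
Proof.
move=> pL [dL pT nL]; split; first exact: cycle_decomp_perm dL pL.
  by apply: perm_trans pT; rewrite perm_sym; apply: perm_flatten.
by rewrite -(perm_mem pL).
Qed.

Lemma full_decomp_has al L (P : pred (seq T)) : full_decomp al L -> has P L ->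
  exists C K, [/\ P C, full_decomp al (C :: K) & size L = (size K).+1].
Proof.
move=> dL /hasP[C LC PC]; have pL := perm_to_rem LC; exists C, (rem C L).
by rewrite (perm_size pL); split=> //; apply: full_decomp_perm dL.
Qed.

(** Distinct lengths at most 7 add up to at most 1 + 2 + ... + 7. *)
Lemma sumn_uniq_le (s : seq nat) : uniq s -> all (fun d => d <= 7) s -> sumn s <= 28.
Proof.
move=> us les; rewrite sumnE; have -> : 28 = \sum_(i <- iota 0 8) i.
  by rewrite unlock.
have ps : perm_eq s [seq i <- iota 0 8 | i \in s].
  apply: uniq_perm; rewrite ?filter_uniq ?iota_uniq // => i.
  rewrite mem_filter mem_iota add0n; case: (boolP (i \in s)) => //= si.
  by have /allP/(_ i si) := les.
rewrite (perm_big _ ps) big_filter [leqRHS](bigID (mem s)) /= leq_addr //.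
Qed.

Lemma even_conjugator_choice (h0 k : {perm T}) : odd_perm h0 ->
  exists j : {perm T}, (j = 1 \/ j = h0) /\ ~~ odd_perm (k * j).
Proof.
move=> oh; have [ok|ek] := boolP (odd_perm k).
  by exists h0; split; [right | rewrite odd_permM ok oh].
by exists 1; split; [left | rewrite mulg1].
Qed.

(** Solves ta * (si^-1) ^ k = ze.  If ta has a cycle of length at least 8, the parity
    of k is controlled by the 7-cycle; otherwise more than 28 points force two
    cycles of equal length, and k may be multiplied by an odd permutation that
    commutes with ta. *)
Lemma hub_quotient si ta A L K :
    full_decomp si (A :: L) -> full_decomp ta K -> ~~ odd_perm si -> ~~ odd_perm ta ->
    8 < size A -> 28 < #|T| -> size K + size L + 7 <= #|T| ->
  exists ze k, [/\ hub_type ze, ~~ odd_perm k & ta = ze * si ^ k].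
Proof.
move=> dsi dta esi eta sA n_gt le_n.
have dsV := full_decompV dsi.
have sizV : size (map rev L) = size L by rewrite size_map.
have sAV : 8 < size (rev A) by rewrite size_rev.
have par : odd_perm ta = odd_perm si^-1 by rewrite odd_permV (negPf esi) (negPf eta).
have sumK := full_decomp_size dta.
have [C [K' [sC dta' sK]]] : exists C K',
    [/\ 1 < size C, full_decomp ta (C :: K') & size K = (size K').+1].
  apply: (full_decomp_has dta); apply: contraTT le_n => /hasPn small.
  have : #|T| <= size K.
    rewrite -sumK; apply: (@leq_trans (1 * size (shape K))); last by rewrite mul1n size_map.
    apply: sumn_le; apply/hasPn => _ /mapP[C KC ->]; exact: small.
  by lia.
have sAV2 : 2 < size (rev A) by apply: leq_trans sAV.
have le1 : size K' + size (map rev L) + 2 <= #|T| by rewrite sizV; lia.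
have [g [h hub_gh]] := hub_factor_conj dta' dsV sC sAV2 par le1.
have conjg_eq (g1 h1 z1 : {perm T}) : ta ^ g1 * si^-1 ^ h1 = z1 ->
    ta = z1 ^ g1^-1 * si ^ (h1 * g1^-1).
  move=> <-; rewrite conjMg -conjgM mulgV conjg1 -conjgM.
  by rewrite conjVg mulgKV.
have [/(full_decomp_has dta)[C8 [K8 [sC8 dta8 sK8]]]|no8] := boolP (has (fun C => 7 < size C) K).
  have le2 : size K8 + size (map rev L) + 8 <= #|T| by rewrite sizV; lia.
  have [g1 [h1 [og oh eqz]]] := hub_type_even_conj dta8 dsV sC8 sAV par le2 hub_gh.
  exists ((ta ^ g * si^-1 ^ h) ^ g1^-1), (h1 * g1^-1); split.
  - exact: hub_typeJ.
  - by rewrite odd_permM odd_permV (negPf og) (negPf oh).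
  - exact: conjg_eq.
have nuK : ~~ uniq (shape K).
  apply: contraL n_gt => uK; rewrite -leqNgt -sumK; apply: sumn_uniq_le => //.
  apply/allP => _ /mapP[D KD ->]; rewrite leqNgt; apply: contra no8 => D8.
  by apply/hasP; exists D.
have [h0 oh0 hta] := odd_centralizer dta nuK.
have [j [j1 oj]] := even_conjugator_choice (h * g^-1) oh0.
have taj : ta ^ j = ta by case: j1 => ->; rewrite ?conjg1.
exists ((ta ^ g * si^-1 ^ h) ^ (g^-1 * j)), (h * g^-1 * j); split=> //.
  exact: hub_typeJ.
have := congr1 (fun u => u ^ j) (conjg_eq g h _ erefl).
by rewrite /= taj [in RHS]conjMg -!conjgM.
Qed.

Lemma far_cube si ta A L K :
    full_decomp si (A :: L) -> full_decomp ta K -> ~~ odd_perm si -> ~~ odd_perm ta ->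
    8 < size A -> 28 < #|T| -> size K + size L + 7 <= #|T| ->
    (size L).*2 + 8 <= #|T| ->
  exists g1 g2 g3 : {perm T}, [/\ ~~ odd_perm g1, ~~ odd_perm g2, ~~ odd_perm g3 &
    si ^ g1 * si ^ g2 * si ^ g3 = ta].
Proof.
move=> dsi dta esi eta sA n_gt le_n le_L.
have [ze [k [hze ok ->]]] := hub_quotient dsi dta esi eta sA n_gt le_n.
rewrite -addnn in le_L.
have [g [h [og oh eqz]]] := hub_type_even_conj dsi dsi (ltnW sA) sA erefl le_L hze.
by exists g, h, k; split=> //; rewrite eqz.
Qed.

(** The longest cycle of si has at least 2 k + 20 points, k being the number of
    cycles.  This is room enough for the support of ta whenever ta has too many
    cycles for the other construction. *)
Theorem class_cube si ta L : full_decomp si L -> ~~ odd_perm si -> ~~ odd_perm ta ->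
    28 < #|T| -> size L * ((size L).*2 + 20) <= #|T| ->
  exists g1 g2 g3 : {perm T}, [/\ ~~ odd_perm g1, ~~ odd_perm g2, ~~ odd_perm g3 &
    si ^ g1 * si ^ g2 * si ^ g3 = ta].
Proof.
move=> dL esi eta n_gt le_n; have [K dK] := exists_full_decomp ta.
have sumL := full_decomp_size dL.
have hasA : has (fun C => (size L).*2 + 20 <= size C) L.
  apply: contraTT n_gt => /hasPn small; rewrite -leqNgt.
  have le : sumn (shape L) <= ((size L).*2 + 19) * size (shape L).
    apply: sumn_le; apply/hasPn => _ /mapP[C LC ->].
    by have := small C LC; rewrite -ltnNge -leqNgt addnS ltnS.
  rewrite sumL size_map in le; move: le le_n; nia.
have [A [K' [sA dA sL]]] := full_decomp_has dL hasA.
rewrite sL in sA le_n.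
have [le_far|lt_near] := leqP (size K + size K' + 7) (sumn (shape L)).
  rewrite sumL in le_far.
  apply: (far_cube dA dK) => //; first by move: sA; clear; lia.
  by move: le_n; clear; nia.
rewrite sumL in lt_near; apply: (near_cube dA dK) => //; move: sA lt_near; clear; lia.
Qed.

End Far.

(** * Permutations with many cycles are rare *)

Section Counting.
Local Open Scope group_scope.
Variable T : finType.
Implicit Types (X Y : {set T}) (s : {perm T}).

(** The symmetric group has one orbit on the subsets of each size. *)
Lemma perm_set_transitive X Y : #|X| = #|Y| -> exists s, s @: X = Y.
Proof.
move=> cXY; pose E (Z : {set T}) := enum Z ++ enum (~: Z).
have pE Z : perm_eq (E Z) (enum T).
  apply: uniq_perm; rewrite ?enum_uniq //.
    rewrite cat_uniq !enum_uniq /= andbT; apply/hasPn => x.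
    by rewrite !mem_enum inE.
  by move=> x; rewrite mem_cat !mem_enum inE orbN.
have uE : uniq (E X) by rewrite (perm_uniq (pE X)) enum_uniq.
have pXY : perm_eq (E X) (E Y) by rewrite (perm_trans (pE X)) // perm_sym.
have [s ms _] := perm_extending_map uE pXY; exists s.
have mX : map s (enum X) = enum Y.
  have := congr1 (take (size (enum Y))) ms.
  by rewrite map_cat !take_cat size_map -!cardE cXY ltnn subnn !take0 !cats0.
apply/setP => y; rewrite -[RHS]mem_enum -mX; apply/imsetP/mapP => -[x Xx ->]; exists x => //.
  by rewrite mem_enum.
by rewrite -mem_enum.
Qed.

Lemma cover_porbits_inj s :
  {in powerset (porbits s) &, injective (@cover T)}.
Proof.
have sub (Q1 Q2 : {set {set T}}) : Q1 \subset porbits s ->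
    Q2 \subset porbits s -> cover Q1 = cover Q2 ->
    Q1 \subset Q2.
  move=> /subsetP s1 /subsetP s2 eqc; apply/subsetP => O Q1O.
  have /imsetP[x _ defO] := s1 O Q1O.
  have : x \in cover Q2 by rewrite -eqc; apply/bigcupP; exists O; rewrite // defO porbit_id.
  case/bigcupP => O2 Q2O2 O2x; have /imsetP[y _ defO2] := s2 O2 Q2O2.
  suff -> : O = O2 by [].
  by apply/eqP; rewrite defO defO2 eq_porbit_mem -defO2.
move=> Q1 Q2; rewrite 2!powersetE => s1 s2 eqc; apply/eqP; rewrite eqEsubset.
by apply/andP; split; apply: sub.
Qed.

(** Unions of cycles are fixed. *)
Lemma card_fixed_sets s :
  2 ^ #|porbits s| <= #|('Fix_([set: {set T}] | 'P^*)[s])%act|.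
Proof.
rewrite -card_powerset -(card_in_imset (@cover_porbits_inj s)).
apply: subset_leq_card; apply/subsetP => _ /imsetP[Q sQ ->]; rewrite inE in sQ.
rewrite inE in_setT; apply/afix1P; rewrite -[LHS]/([set aperm x s | x in cover Q]).
apply/eqP; rewrite eqEcard card_imset; last exact: perm_inj.
rewrite leqnn andbT; apply/subsetP => _ /imsetP[x /bigcupP[O QO Ox] ->].
apply/bigcupP; exists O => //; have /imsetP[y _ defO] := subsetP sQ O QO.
rewrite defO in Ox *; rewrite -eq_porbit_mem in Ox; rewrite -(eqP Ox).
exact: (mem_porbit s 1%N x).
Qed.

(** Burnside's formula: the numbers of fixed subsets add up to the number of orbits,
    #|T| + 1, times the order of the group. *)
Lemma sum_exp_porbits : \sum_(s : {perm T}) 2 ^ #|porbits s| <= #|T|.+1 * #|T|`!.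
Proof.
have actsT : [acts [set: {perm T}], on [set: {set T}] | 'P^*].
  by apply/actsP => s _ X; rewrite !inE.
apply: leq_trans (_ : \sum_(s in [set: {perm T}]) #|('Fix_([set: {set T}] | 'P^*)[s])%act| <= _).
  rewrite [leqRHS](eq_bigl xpredT); last by move=> s; rewrite inE.
  by apply: leq_sum => s _; apply: card_fixed_sets.
have cardG : #|[set: {perm T}]| = #|T|`!.
  rewrite -cardsT -card_perm; apply: eq_card => s; rewrite !inE.
  by apply/esym/subsetP => x; rewrite inE.
rewrite (Frobenius_Cauchy actsT) -cardG leq_mul2r; apply/orP; right.
rewrite -[X in _ <= X]card_ord -[X in _ <= X]cardsT.
pose F (k : 'I_(#|T|.+1)) := [set Y : {set T} | #|Y| == k].
apply: leq_trans (leq_imset_card F _); apply: subset_leq_card.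
apply/subsetP => _ /imsetP[X _ ->]; apply/imsetP.
have ltX : #|X| < #|T|.+1 by rewrite ltnS max_card.
exists (Ordinal ltX) => //; apply/setP => Y; rewrite inE /=.
apply/orbitP/eqP => [[s _ <-]|/esym/perm_set_transitive[s <-]].
  by apply: card_imset; apply: perm_inj.
by exists s; rewrite ?inE.
Qed.

Lemma card_many_porbits (A : {set {perm T}}) k :
  {in A, forall s, k <= #|porbits s|} -> #|A| * 2 ^ k <= #|T|.+1 * #|T|`!.
Proof.
move=> geA; apply: leq_trans sum_exp_porbits.
rewrite (bigID (mem A)) /= -sum_nat_const; apply: leq_trans (leq_addr _ _).
by apply: leq_sum => s As; rewrite leq_exp2l // geA.
Qed.

End Counting.

(** * Density estimates and conclusion *)

Section Combinatorial.
Variables (n : nat) (A : {set 'S_n}).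
Hypothesis nA : normal_subset_Alt A.

Lemma cube_eq_Alt si : si \in A -> (28 < n)%N ->
  (#|porbits si| * (#|porbits si|.*2 + 20) <= n)%N -> (A * A * A = 'Alt_('I_n))%g.
Proof.
have [sA nJ] := nA; move=> Asi n_gt le_n; apply/eqP; rewrite eqEsubset; apply/andP; split.
  have := mulgSS (mulgSS sA sA) sA; by rewrite !mulGid.
have [L dL] := exists_full_decomp si; rewrite (card_porbits_full_decomp dL) in le_n.
have esi : ~~ odd_perm si by rewrite -Alt_even (subsetP sA).
apply/subsetP => ta; rewrite Alt_even => eta.
have [||g1 [g2 [g3 [o1 o2 o3 <-]]]] := class_cube dL esi eta; rewrite ?card_ord //.
by rewrite !mem_mulg // nJ // Alt_even.
Qed.

(** If every element of A has too many cycles for [class_cube], the count of such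
    permutations bounds A; 22 k ^ 2 bounds k (2 k + 20) for k > 0. *)
Lemma cube_or_many_cycles : (28 < n)%N -> (A * A * A = 'Alt_('I_n))%g \/
  forall k, (22 * k ^ 2 < n)%N -> (#|A| * 2 ^ k <= n.+1 * n`!)%N.
Proof.
move=> n_gt.
have [/existsP[si /andP[Asi le_n]]|none] :=
    boolP [exists si in A, (#|porbits si| * (#|porbits si|.*2 + 20) <= n)%N].
  by left; apply: (cube_eq_Alt Asi).
right=> k ltk; have := @card_many_porbits _ A k; rewrite card_ord; apply.
move=> si Asi; rewrite leqNgt; apply: contra none => lt_k.
apply/existsP; exists si; rewrite Asi /=; apply: ltnW; apply: leq_ltn_trans ltk.
by rewrite -mulnn; move: (#|porbits si|) lt_k => p; clear; nia.
Qed.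

End Combinatorial.

Import Order.TTheory GRing.Theory Num.Theory.
Local Open Scope ring_scope.

Section Analysis.
Variable R : realType.
Implicit Types (c : R).

(** As log x < x at x = n ^ (1/6), n ^ (1/3) log n is at most 6 sqrt n. *)
Lemma density_lower_bound c n : 0 <= c ->
  expR (- (6 * c * Num.sqrt (n%:R : R))) <= (n%:R : R) `^ (- (c * n%:R `^ (3%:R)^-1)).
Proof.
move=> c_ge0; case: n => [|n].
  by rewrite sqrtr0 mulr0 oppr0 expR0 /powR eqxx invr_eq0 pnatr_eq0 /= mulr0 oppr0 eqxx.
set N : R := n.+1%:R; have N_gt0 : 0 < N by rewrite ltr0n.
rewrite [leRHS]/powR gt_eqF // ler_expR mulNr lerN2.
have lnN : ln N <= 6 * N `^ (6%:R)^-1.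
  have := ln_sublinear (powR_gt0 (6%:R)^-1 N_gt0); rewrite ln_powR => /ltW.
  by rewrite mulrC ler_pdivrMr ?ltr0n // mulrC.
have -> : Num.sqrt N = N `^ 3^-1 * N `^ 6^-1.
  rewrite -powRD; last by apply/implyP => _; rewrite gt_eqF.
  by rewrite -powR12_sqrt ?ltW //; congr (_ `^ _); lra.
have := ler_wpM2l (mulr_ge0 c_ge0 (powR_ge0 N 3^-1)) lnN.
by move/le_trans; apply; rewrite le_eqVlt; apply/orP; left; apply/eqP; ring.
Qed.

Lemma expR_half_le : expR (2^-1 : R) <= 2.
Proof.
have := expR_ge1Dx (- 2^-1 : R); rewrite expRN.
rewrite (_ : 1 + - 2^-1 = 2^-1 :> R); last by lra.
by rewrite lef_pV2 // ?posrE ?expR_gt0 // ltr0n.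
Qed.

(** Taking fourth powers in expR y >= 1 + y at y = t - 1/8 bounds the exponential
    below by t ^ 4. *)
Lemma expR_gt_quadratic (t : R) : 160 < t -> 4 * (80 * t) ^+ 2 < expR (4 * t - 2^-1).
Proof.
move=> t_gt; have -> : 4 * t - 2^-1 = 4%:R * (t - 8^-1) by lra.
rewrite expRM_natl; have := expR_ge1Dx (t - 8^-1) => le1.
apply: (@lt_le_trans _ _ (t ^+ 4)); last by apply: lerXn2r; rewrite ?nnegrE ?expR_ge0 //; lra.
rewrite (_ : 4 * (80 * t) ^+ 2 = (160 * t) ^+ 2); last by ring.
rewrite (_ : t ^+ 4 = (t * t) ^+ 2); last by ring.
rewrite ltr_pXn2r // ?nnegrE; [| by apply: mulr_ge0; lra | by apply: mulr_ge0; lra].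
by rewrite ltr_pM2r //; lra.
Qed.

(** Let s = sqrt n and let k be the integer part of s / 5.  If the conclusion failed,
    all elements of A would have at least k cycles, and the density would be at most
    2 (n + 1) / 2 ^ k, which is less than exp (- s / 20). *)
Lemma large_case c n (A : {set 'S_n}) : 0 <= c -> 120 * c <= 1 -> 80 * 160 < Num.sqrt (n%:R : R) ->
  normal_subset_Alt A -> expR (- (6 * c * Num.sqrt (n%:R : R))) <= density_Alt R A ->
  (A * A * A = 'Alt_('I_n))%g.
Proof.
set s := Num.sqrt _ => c_ge0 c_le s_gt nA dens.
have s2 : s ^+ 2 = n%:R by rewrite sqr_sqrtr ?ler0n.
have n_gt : (28 < n)%N.
  by rewrite -(ltr_nat R) -s2 expr2; nra.
have [//|few] := cube_or_many_cycles nA n_gt.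
pose k := Num.truncn (s / 5).
have /andP[lek ltk] : k%:R <= s / 5 < k.+1%:R by rewrite truncn_itv //; lra.
have hk : (22 * k ^ 2 < n)%N.
  rewrite -(ltr_nat R) natrM natrX -s2 !expr2; have : (0 : R) <= k%:R by rewrite ler0n.
  by nra.
have := few k hk; have cA : (2 * #|('Alt_('I_n))%g|)%N = n`!.
  by rewrite card_Alt card_ord //; apply: leq_trans n_gt.
rewrite -cA -(ler_nat R) !natrM natrX => le_count.
have alt_gt0 : 0 < #|('Alt_('I_n))%g|%:R :> R by rewrite ltr0n cardG_gt0.
move: dens; rewrite /density_Alt ler_pdivlMr // => dens.
have e2k : expR (k%:R * 2^-1) <= 2 ^+ k :> R.
  by rewrite expRM_natl; apply: lerXn2r; rewrite ?nnegrE ?expR_ge0 ?expR_half_le // ler0n.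
have le1 : expR (- (6 * c * s)) * expR (k%:R * 2^-1) <= 2 * n.+1%:R :> R.
  rewrite -(ler_pM2r alt_gt0); apply: (@le_trans _ _ (#|A|%:R * 2 ^+ k)).
    rewrite mulrAC; apply: ler_pM => //; rewrite ?expR_ge0 //.
    by rewrite mulr_ge0 ?expR_ge0 // ltW.
  by apply: le_trans le_count _; rewrite le_eqVlt; apply/orP; left; apply/eqP; ring.
have := @expR_gt_quadratic (s / 80); rewrite (_ : 80 * (s / 80) = s); last by lra.
move=> /(_ ltac:(lra)) lt2.
suff : expR (4 * (s / 80) - 2^-1) <= 4 * s ^+ 2 by rewrite leNgt lt2.
apply: (@le_trans _ _ (2 * n.+1%:R)); last first.
  by rewrite -[n.+1%:R]natr1 -s2 expr2; nra.
apply: le_trans le1; rewrite -expRD ler_expR.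
by move: ltk; rewrite -[k.+1%:R]natr1 => ltk; nra.
Qed.

Lemma small_case (m n : nat) (A : {set 'S_n}) : (n`! <= m)%N ->
  normal_subset_Alt A -> 1 - m%:R^-1 < density_Alt R A ->
  (A * A * A = 'Alt_('I_n))%g.
Proof.
move=> le_m [sA _] dens; suff -> : A = ('Alt_('I_n))%g by rewrite !mulGid.
apply/eqP; rewrite eqEcard sA /= leqNgt; apply/negP => ltA.
have alt_gt0 : (0 : R) < #|('Alt_('I_n))%g|%:R by rewrite ltr0n cardG_gt0.
have le_alt : (#|('Alt_('I_n))%g| <= m)%N.
  by apply: leq_trans le_m; rewrite -card_Sn; apply: max_card.
move: dens; rewrite ltNge => /negP; apply; rewrite /density_Alt ler_pdivrMr //.
rewrite mulrBl mul1r; apply: (@le_trans _ _ (#|('Alt_('I_n))%g|%:R - 1)).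
  by rewrite lerBrDr natr1 ler_nat.
rewrite lerD2l lerN2 mulrC ler_pdivrMr ?mul1r ?ler_nat //.
by apply: lt_le_trans alt_gt0 _; rewrite ler_nat.
Qed.

End Analysis.

Theorem corollary2p7 (R : realType) :
  exists c : R, 0 < c /\
    forall (n : nat) (A : {set 'S_n}),
      normal_subset_Alt A ->
      n%:R `^ (- (c * n%:R `^ (3%:R)^-1)) <= density_Alt R A ->
      (A * A * A = 'Alt_('I_n))%g.
Proof.
pose q : R := 80 * 160; have q_gt1 : 1 <= q by rewrite /q; lra.
pose m := (Num.truncn (q ^+ 2))`!.
have m_gt0 : (0 : R) < m%:R by rewrite ltr0n fact_gt0.
have m_ge1 : (1 : R) <= m%:R by rewrite ler1n fact_gt0.
have qm_ge1 : 1 <= q * m%:R by apply: mulr_ege1.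
(* So small that 6 c sqrt n < 1 / m, and m bounds n!, as long as sqrt n <= q. *)
pose c : R := (120 * (q * m%:R))^-1.
have qm_gt0 : 0 < q * m%:R by lra.
have c_gt0 : 0 < c by rewrite invr_gt0 mulr_gt0 // ltr0n.
have cqm : c * (120 * (q * m%:R)) = 1.
  by rewrite mulVf // lt0r_neq0 // mulr_gt0 // ltr0n.
have c_le : 120 * c <= 1 by nra.
exists c; split=> // n A nA dens.
have {}dens := le_trans (density_lower_bound n (ltW c_gt0)) dens.
have [s_le|s_gt] := leP (Num.sqrt (n%:R : R)) q; last first.
  exact: large_case (ltW c_gt0) c_le s_gt nA dens.
have s_ge0 : 0 <= Num.sqrt (n%:R : R) := sqrtr_ge0 _.
apply: (small_case (R := R) (m := m)) nA _.
  suff le_n : (n <= Num.truncn (q ^+ 2))%N.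
    by apply: dvdn_leq (fact_gt0 _) _; rewrite (fact_split le_n) dvdn_mulr.
  rewrite truncn_ge_nat; last by rewrite exprn_ge0 //; lra.
  rewrite -(sqr_sqrtr (ler0n R n)).
  by apply: lerXn2r; rewrite ?nnegrE //; lra.
apply: lt_le_trans dens; apply: lt_le_trans (expR_ge1Dx _).
rewrite ltrD2l ltrN2 -[ltRHS]mul1r ltr_pdivlMr //.
have cm_gt0 : 0 < c * m%:R by apply: mulr_gt0.
have := ler_wpM2l (ltW cm_gt0) s_le; lra.
Qed.
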